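(* Let $T>0$, let $u_0:\mathcal P(G)\to\mathbb R$ be Fréchet continuously differentiable, and for $\mu\in\mathcal P(G)$ let $\sigma(\cdot,\mu)=\sigma^\mu:[0,T]\to\mathcal P(G)$ be the unique solution of $\dot\sigma=\xi(\sigma)$, $\sigma(0)=\mu$. Set $u(t,\mu)=u_0(\sigma(t,\mu))$ for $t\in[0,T]$, $\mu\in\mathcal P(G)$. Then: (i) $u$ is continuously differentiable, that is, the time derivative $\partial_tu(t,\mu)$ and the Fréchet derivative $\frac{\delta u}{\delta\mu}(t,\mu)$ in $\mu$ exist and are continuous on $[0,T]\times\mathcal P(G)$. (ii) $\partial_tu(t,\mu)=\Delta_{\mathrm{ind}}u(t,\mu)$.
   Context: $G=(V,E,\omega)$ is a finite, simple, connected, undirected graph with $V=\{1,\dots,n\}$, $E\subset V^2$ (sums over $(i,j)\in E$ run over ordered pairs), and $\omega=(\omega_{ij})$ a symmetric $n\times n$ matrix with $\omega_{ij}>0$ if $(i,j)\in E$ and $\omega_{ij}=0$ otherwise; $N(i)$ is the set of vertices connected to $i$ by an edge. $\mathcal P(G)=\{\rho\in\mathbb R^n:\sum_i\rho_i=1,\ \rho_i\ge0\}$. $(\cdot,\cdot)$ is the Euclidean inner product on $\mathbb R^n$. $g:[0,1]^2\to[0,\infty)$ satisfies: $g\in C([0,1]^2)\cap C^\infty((0,1)^2)$; $g(s,t)=g(t,s)$; $g$ is concave; $g(\lambda s,\lambda t)=\lambda g(s,t)$ for $\lambda>0$; $\min\{s,t\}\le g(s,t)\le\max\{s,t\}$.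 It is extended to $[0,\infty)^2$ by homogeneity. Write $g_{ij}(\rho)=g(\rho_i,\rho_j)$. Standing assumptions: (a) $g(s,t)=0$ if $st=0$; (b) $\bar g(s,t)=(\log s-\log t)g(s,t)$, defined for $s,t>0$, admits a continuous extension to $[0,\infty)^2$, still denoted $\bar g$; let $\xi:[0,\infty)^n\to\mathbb R^n$, $\xi_i(\mu)=\sum_{j\in N(i)}\omega_{ij}\,\bar g(\mu_j,\mu_i)$, which extends $\mu\mapsto\operatorname{div}_\mu(\nabla_G\log\mu)$; (c) $\xi$ is Lipschitz and of class $C^1$ (up to the boundary). For $\phi\in\mathbb R^n$, $(\nabla_G\phi)_{ij}=\sqrt{\omega_{ij}}(\phi_i-\phi_j)$. For skew-symmetric $v,\bar v\in\mathbb R^{n\times n}$: $(\operatorname{div}_\rho(v))_i=\sum_{j\in N(i)}\sqrt{\omega_{ij}}\,g_{ij}(\rho)v_{ji}$ and $(v,\bar v)_\rho=\frac12\sum_{(i,j)\in E}g_{ij}(\rho)v_{ij}\bar v_{ij}$. $\log\mu$ is taken componentwise. A function $\mathcal F:\mathcal P(G)\to\mathbb R$ has Fréchet derivative $f=\frac{\delta\mathcal F}{\delta\rho}(\rho)\in\mathbb R^n$ at $\rho$ if $\sum_if_i=0$ and for every $\bar\rho\in\mathcal P(G)$, $\lim_{t\to0}\frac{\mathcal F((1-t)\rho+t\bar\rho)-\mathcal F(\rho)}{t}=(f,\bar\rho-\rho)$ (the limit being over $t$ with $(1-t)\rho+t\bar\rho\in\mathcal P(G)$). $\mathcal F$ is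 Fréchet continuously differentiable if it has a Fréchet derivative at every $\rho\in\mathcal P(G)$ and $\rho\mapsto\frac{\delta\mathcal F}{\delta\rho}(\rho)$ is continuous. In that case its Wasserstein gradient is $\nabla_{\mathcal W}\mathcal F(\rho)=\nabla_G\big(\frac{\delta\mathcal F}{\delta\rho}(\rho)\big)$. The individual noise operator is $\Delta_{\mathrm{ind}}u(t,\mu)=\big(\operatorname{div}_\mu(\nabla_{\mathcal W}u(t,\mu)),\log\mu\big)=-(\nabla_{\mathcal W}u(t,\mu),\nabla_G\log\mu)_\mu$, with the gradient taken in $\mu$. Equivalently it equals $\big(\frac{\delta u}{\delta\mu}(t,\mu),\xi(\mu)\big)$, and this last expression is its meaning when some $\mu_i=0$. *)

(* Defs.v *)
From mathcomp Require Import all_boot all_order all_algebra.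
From mathcomp Require Import all_classical all_reals all_analysis.
Import Order.TTheory GRing.Theory Num.Theory.
Import numFieldNormedType.Exports.

Set Implicit Arguments.
Unset Strict Implicit.
Unset Printing Implicit Defensive.

Local Open Scope classical_set_scope.
Local Open Scope ring_scope.

(** Finite weighted graphs on the vertex set {0, ..., n-1}; points of R^n are
    row vectors. *)
Record weighted_graph (R : realType) (n : nat) (e : rel 'I_n)
    (w : 'M[R]_n) : Prop := WeightedGraph {
  edge_sym : symmetric e;
  edge_irrefl : irreflexive e;
  edge_connected : forall i j, connect e i j;
  weight_sym : forall i j, w i j = w j i;
  weight_pos : forall i j, e i j -> 0 < w i j;
  weight_eq0 : forall i j, ~~ e i j -> w i j = 0 }.

Definition simplex (R : realType) (n : nat) : set 'rV[R]_n :=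
  [set rho | \sum_i rho 0 i = 1 /\ forall i, 0 <= rho 0 i].

Definition orthant (R : realType) (n : nat) : set 'rV[R]_n :=
  [set mu | forall i, 0 <= mu 0 i].

Definition open_orthant (R : realType) (n : nat) : set 'rV[R]_n :=
  [set mu | forall i, 0 < mu 0 i].

Definition dotv (R : realType) (n : nat) (x y : 'rV[R]_n) : R :=
  \sum_i x 0 i * y 0 i.

Section Smooth.
Variable R : realType.

Definition axis (b : bool) : R * R := if b then (0, 1) else (1, 0).

Definition partial (b : bool) (f : R * R -> R) : R * R -> R :=
  fun x => 'D_(axis b) f x.

(** C^oo on an open set U: all iterated partial derivatives exist and are
    continuous on U.  The values of f outside U play no role, since U is
    open. *)
Definition smooth_on (U : set (R * R)) (f : R * R -> R) : Prop :=
  forall (s : seq bool) (x : R * R), U x ->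
    let h := foldr partial f s in
    {for x, continuous h} /\ forall b, derivable h x (axis b).

End Smooth.

(** [g] is given on [0, +oo[ ^ 2.  The regularity, symmetry, concavity and
    bounds are required on [0, 1] ^ 2 only; [interp_homog] expresses both the
    homogeneity of g and that g is extended to [0, +oo[ ^ 2 by homogeneity. *)
Record interpolation (R : realType) (g : R -> R -> R) : Prop := Interpolation {
  interp_ge0 : forall s t, 0 <= s <= 1 -> 0 <= t <= 1 -> 0 <= g s t;
  interp_cont : {within `[0, 1] `*` `[0, 1],
    continuous (fun p : R * R => g p.1 p.2)};
  interp_smooth : smooth_on (`]0, 1[ `*` `]0, 1[)
    (fun p : R * R => g p.1 p.2);
  interp_sym : forall s t, 0 <= s <= 1 -> 0 <= t <= 1 -> g s t = g t s;
  interp_concave : forall s t s' t' a,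
    0 <= s <= 1 -> 0 <= t <= 1 -> 0 <= s' <= 1 -> 0 <= t' <= 1 ->
    0 <= a <= 1 ->
    (1 - a) * g s t + a * g s' t' <=
      g ((1 - a) * s + a * s') ((1 - a) * t + a * t');
  interp_homog : forall a s t, 0 < a -> 0 <= s -> 0 <= t ->
    g (a * s) (a * t) = a * g s t;
  interp_bounds : forall s t, 0 <= s <= 1 -> 0 <= t <= 1 ->
    Num.min s t <= g s t <= Num.max s t }.

(** [gb] is the continuous extension to [0, +oo[ ^ 2 of
    (s, t) |-> (log s - log t) g(s, t). *)
Definition log_extension (R : realType) (g gb : R -> R -> R) : Prop :=
  (forall s t, 0 < s -> 0 < t -> gb s t = (ln s - ln t) * g s t) /\
  {within `[0, +oo[ `*` `[0, +oo[, continuous (fun p : R * R => gb p.1 p.2)}.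

Definition xi (R : realType) (n : nat) (e : rel 'I_n) (w : 'M[R]_n)
    (gb : R -> R -> R) (mu : 'rV[R]_n) : 'rV[R]_n :=
  \row_i \sum_(j | e i j) w i j * gb (mu 0 j) (mu 0 i).

(** C^1 up to the boundary: differentiable in the open orthant, with a Jacobian
    extending continuously to the closed orthant. *)
Definition C1_orthant (R : realType) (n : nat) (f : 'rV[R]_n -> 'rV[R]_n) :
    Prop :=
  exists J : 'rV[R]_n -> 'M[R]_n,
    {within @orthant R n, continuous J} /\
    forall mu, open_orthant mu -> differentiable f mu /\ 'J f mu = J mu.

Definition graph_grad (R : realType) (n : nat) (w : 'M[R]_n)
    (phi : 'rV[R]_n) : 'M[R]_n :=
  \matrix_(i, j) (Num.sqrt (w i j) * (phi 0 i - phi 0 j)).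

Definition graph_div (R : realType) (n : nat) (e : rel 'I_n) (w : 'M[R]_n)
    (g : R -> R -> R) (rho : 'rV[R]_n) (v : 'M[R]_n) : 'rV[R]_n :=
  \row_i \sum_(j | e i j) Num.sqrt (w i j) * g (rho 0 i) (rho 0 j) * v j i.

(** Functions on the simplex are represented by total functions on R^n; only
    their values on the simplex matter below. *)
Definition is_frechet (R : realType) (n : nat) (F : 'rV[R]_n -> R)
    (rho f : 'rV[R]_n) : Prop :=
  \sum_i f 0 i = 0 /\
  forall rho', simplex rho' ->
    (F ((1 - t) *: rho + t *: rho') - F rho) / t
      @[t --> within [set t | simplex ((1 - t) *: rho + t *: rho')] 0^']
      --> dotv f (rho' - rho).

Definition frechet_derivable (R : realType) (n : nat) (F : 'rV[R]_n -> R)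
    (rho : 'rV[R]_n) : Prop :=
  exists f, is_frechet F rho f.

Definition frechet (R : realType) (n : nat) (F : 'rV[R]_n -> R)
    (rho : 'rV[R]_n) : 'rV[R]_n :=
  xget 0 [set f | is_frechet F rho f].

Definition frechet_C1 (R : realType) (n : nat) (F : 'rV[R]_n -> R) : Prop :=
  (forall rho, simplex rho -> frechet_derivable F rho) /\
  {within @simplex R n, continuous (frechet F)}.

Definition wasserstein_grad (R : realType) (n : nat) (w : 'M[R]_n)
    (F : 'rV[R]_n -> R) (rho : 'rV[R]_n) : 'M[R]_n :=
  graph_grad w (frechet F rho).

(** The individual noise operator; the second branch gives its meaning when
    some coordinate of mu vanishes. *)
Definition ind_noise (R : realType) (n : nat) (e : rel 'I_n) (w : 'M[R]_n)
    (g gb : R -> R -> R) (F : 'rV[R]_n -> R) (mu : 'rV[R]_n) : R :=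
  if [forall i, 0 < mu 0 i]
  then dotv (graph_div e w g mu (wasserstein_grad w F mu)) (map_mx (@ln R) mu)
  else dotv (frechet F mu) (xi e w gb mu).

(** Derivative at t relative to a set A of times: one-sided at the end points
    of an interval. *)
Definition is_deriv_on (R : realType) (V : normedModType R) (A : set R)
    (f : R -> V) (t : R) (l : V) : Prop :=
  h^-1 *: (f (t + h) - f t) @[h --> within [set h | A (t + h)] 0^'] --> l.

Definition deriv_on (R : realType) (A : set R) (f : R -> R) (t : R) : R :=
  xget 0 [set l : R | is_deriv_on A (f : R -> R^o) t l].

(* Main.v *)
Require Import Defs.
From mathcomp Require Import all_boot all_order all_algebra.
From mathcomp Require Import all_classical all_reals all_analysis.
From mathcomp Require Import ring lra.
Import Order.TTheory GRing.Theory Num.Theory.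
Import numFieldNormedType.Exports.
Local Open Scope classical_set_scope.
Local Open Scope ring_scope.

(** Why the theorem holds.  Write f for the Frechet derivative of u0.  The mean
    value theorem on segments and uniform continuity on the compact simplex give
    the expansion u0(b) - u0(a) = f(a).(b - a) + o(|b - a|), uniformly in a
    ([frechet_C1_expansion]).  Hence the chain rule along curves in the simplex
    ([frechet_chain_rule]), and in particular the time derivative of u is
    f(sigma).xi(sigma), which is continuous because the flow is.

    The Frechet derivative of u(t, .) requires the differentiability of the flow
    in its starting point.  The variational equation is never solved: instead,
    one considers a linear relation sum_k a_k (nu_k - mu) = 0 between increments
    of the starting point.  The combination Z(t) = sum_k a_k (sigma(t, nu_k) -
    sigma(t, mu)) vanishes at t = 0 and satisfies Z' = Z J(sigma) up to an error
    that is small compared with sum_k |a_k| |nu_k - mu|, J being the Jacobian of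
    xi ([C1_orthant_expansion]); by the Gronwall inequality Z stays small on
    [0, T] ([flow_almost_linear]).  This almost linearity passes to u
    ([frechet_C1_comp_almost_linear]).

    Almost linearity is all that is needed to differentiate on a simplex.
    Applied to two increments in the same direction it says that difference
    quotients are uniformly Cauchy; applied to an arbitrary direction and to the
    directions of the vertices it says that their limit depends linearly on the
    direction.  The derivative is jointly continuous as a uniform limit of
    continuous quotients ([almost_linear_frechet]).

    For the equation, u(t + h, mu) = u(t, sigma(h, mu)) by uniqueness of
    solutions ([flow_semigroup]).  Differentiating both sides at h = 0+ shows
    that the time derivative is the Frechet derivative of u(t, .) applied to
    xi(mu); this works for t < T, and both sides are continuous up to t = T.
    Finally the noise operator is the same expression by summation by parts on
    the graph ([ind_noiseE]). *)

Set Implicit Arguments.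
Unset Strict Implicit.
Unset Printing Implicit Defensive.

(** * Derivatives relative to a set of times *)

Lemma within_dnbhs0P (R : realType) (D P : set R) :
  (\forall h \near within D 0^', P h) <->
  exists2 d, 0 < d & forall h, h != 0 -> `|h| < d -> D h -> P h.
Proof.
split=> [/nbhs_ballP[d /= d0 dP]|[d d0 dP]].
  exists d => // h h0 hd Dh; apply: (dP h) => //.
  by rewrite -ball_normE /ball_ /= sub0r normrN.
apply/nbhs_ballP; exists d => //= h; rewrite -ball_normE /ball_ /= sub0r normrN.
by move=> hd h0; exact: dP.
Qed.

Lemma within_continuousP (R : realType) (V W : normedModType R) (A : set V)
    (f : V -> W) :
  {within A, continuous f} <->
  forall x, A x -> forall eps, 0 < eps -> exists2 d, 0 < d &
    forall y, A y -> `|y - x| < d -> `|f y - f x| <= eps.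
Proof.
rewrite subspace_continuousP; split=> [fc x Ax eps eps0|fc x Ax].
  move/fc : (Ax) => /cvgrPdist_le /(_ _ eps0) /nbhs_ballP[d /= d0 dP].
  exists d => // y Ay yx; rewrite distrC; apply: dP => //.
  by rewrite -ball_normE /ball_ /= distrC.
apply/cvgrPdist_le => eps eps0; have [d d0 dP] := fc x Ax eps eps0.
apply/nbhs_ballP; exists d => //= y; rewrite -ball_normE /ball_ /= => xy Ay.
by rewrite distrC; apply: dP => //; rewrite distrC.
Qed.

Lemma is_deriv_onP (R : realType) (V : normedModType R) (A : set R)
    (f : R -> V) (t : R) (l : V) :
  is_deriv_on A f t l <->
  forall eps, 0 < eps -> exists2 d, 0 < d &
    forall h, `|h| < d -> A (t + h) ->
      `|f (t + h) - f t - h *: l| <= eps * `|h|.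
Proof.
have E h : h != 0 -> `|f (t + h) - f t - h *: l| =
    `|l - h^-1 *: (f (t + h) - f t)| * `|h|.
  by move=> h0; rewrite mulrC -normrZ scalerBr scalerA divff// scale1r distrC.
rewrite /is_deriv_on; split=> [/cvgrPdist_le fl eps eps0|fl].
  have /within_dnbhs0P[d d0 dP] := fl _ eps0; exists d => // h hd Ah.
  have [->|h0] := eqVneq h 0.
    by rewrite addr0 subrr scale0r subr0 !normr0 mulr0.
  by rewrite E// ler_wpM2r// dP.
apply/cvgrPdist_le => eps eps0; apply/within_dnbhs0P.
have [d d0 dP] := fl _ eps0; exists d => // h h0 hd Ah.
by have := dP _ hd Ah; rewrite E// ler_pM2r// normr_gt0.
Qed.

Lemma is_deriv_on_subset {R : realType} {V : normedModType R} {A B : set R}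
    {f : R -> V} {t : R} {l : V} :
  A `<=` B -> is_deriv_on B f t l -> is_deriv_on A f t l.
Proof.
move=> AB /is_deriv_onP fl; apply/is_deriv_onP => eps /fl[d d0 dP].
by exists d => // h hd /AB; exact: dP.
Qed.

Lemma is_deriv_on_shift (R : realType) (V : normedModType R) (A : set R)
    (f : R -> V) (s t : R) (l : V) :
  is_deriv_on A f (t + s) l ->
  is_deriv_on [set h | A (h + s)] (fun h => f (h + s)) t l.
Proof.
move=> /is_deriv_onP fl; apply/is_deriv_onP => eps /fl[d d0 dP].
by exists d => // h hd /=; rewrite -[t + h + s]addrAC; exact: dP.
Qed.

Lemma is_deriv_onD (R : realType) (V : normedModType R) (A : set R)
    (f g : R -> V) (t : R) (l m : V) :
  is_deriv_on A f t l -> is_deriv_on A g t m ->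
  is_deriv_on A (fun s => f s + g s) t (l + m).
Proof.
rewrite /is_deriv_on => fl gm; apply: cvg_trans (cvgD fl gm).
apply: near_eq_cvg; apply: nearW => h.
by rewrite !fctE -scalerDr opprD addrACA.
Qed.

Lemma is_deriv_onB (R : realType) (V : normedModType R) (A : set R)
    (f g : R -> V) (t : R) (l m : V) :
  is_deriv_on A f t l -> is_deriv_on A g t m ->
  is_deriv_on A (fun s => f s - g s) t (l - m).
Proof.
rewrite /is_deriv_on => fl gm; apply: cvg_trans (cvgB fl gm).
apply: near_eq_cvg; apply: nearW => h.
by rewrite !fctE -scalerBr !opprD !opprK addrACA.
Qed.

Lemma is_deriv_onZ (R : realType) (V : normedModType R) (A : set R)
    (a : R) (f : R -> V) (t : R) (l : V) :
  is_deriv_on A f t l -> is_deriv_on A (fun s => a *: f s) t (a *: l).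
Proof.
rewrite /is_deriv_on => fl; apply: cvg_trans (cvgZl_tmp (k := a) fl).
apply: near_eq_cvg; apply: nearW => h.
by rewrite /= -scalerBr !scalerA mulrC.
Qed.

Lemma is_deriv_on_sum (R : realType) (V : normedModType R) (A : set R)
    (I : finType) (a : I -> R) (f : I -> R -> V) (t : R) (l : I -> V) :
  (forall i, is_deriv_on A (f i) t (l i)) ->
  is_deriv_on A (fun s => \sum_i a i *: f i s) t (\sum_i a i *: l i).
Proof.
move=> fl; elim: (index_enum I) => [|i s IH].
  apply/is_deriv_onP => eps eps0; exists 1 => // h _ _.
  by rewrite /= !big_nil subrr scaler0 subr0 normr0 mulr_ge0// ltW.
rewrite big_cons [X in is_deriv_on _ X](_ : _ =
    (fun u => a i *: f i u + \sum_(j <- s) a j *: f j u)); last first.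
  by apply/funext => u; rewrite big_cons.
exact: is_deriv_onD (is_deriv_onZ (fl i)) IH.
Qed.

Lemma within_dnbhs0_proper (R : realType) (D : set R) :
  (forall d, 0 < d -> exists2 h, h != 0 /\ `|h| < d & D h) ->
  ProperFilter (within D 0^').
Proof.
move=> DP; apply: Build_ProperFilter => // /within_dnbhs0P[d /DP[h [h0 hd] Dh]].
by move=> /(_ h h0 hd Dh).
Qed.

(** At an end point of [0, T] only the increments pointing inwards are admitted;
    there are always some, which makes the relative derivative unique. *)
Lemma itv_increment_proper (R : realType) (T t : R) :
  0 < T -> 0 <= t <= T ->
  ProperFilter (within [set h | `[0, T]%classic (t + h)] 0^').
Proof.
move=> T0 /andP[t0 tT]; apply: within_dnbhs0_proper => d d0.
pose m := Num.min (d / 2) (T / 2).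
have m0 : 0 < m by rewrite lt_min !divr_gt0.
have [md mT] : m <= d / 2 /\ m <= T / 2 by split; rewrite ge_min lexx ?orbT.
have [tT2|tT2] := leP t (T / 2).
  exists m; first by rewrite gt_eqF// gtr0_norm//; split=> //; lra.
  by rewrite /= in_itv /=; apply/andP; split; lra.
exists (- m); first by rewrite oppr_eq0 gt_eqF// normrN gtr0_norm//; split=> //; lra.
by rewrite /= in_itv /=; apply/andP; split; lra.
Qed.

Lemma is_deriv_on_unique (R : realType) (V : normedModType R) (T : R)
    (f : R -> V) (t : R) (l m : V) :
  0 < T -> 0 <= t <= T ->
  is_deriv_on `[0, T] f t l -> is_deriv_on `[0, T] f t m -> l = m.
Proof.
move=> T0 tT; have FF := itv_increment_proper T0 tT; exact: cvg_unique.
Qed.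

Lemma deriv_onE (R : realType) (T : R) (f : R -> R) (t l : R) :
  0 < T -> 0 <= t <= T -> is_deriv_on `[0, T] (f : R -> R^o) t l ->
  deriv_on `[0, T] f t = l.
Proof.
move=> T0 tT fl; rewrite /deriv_on.
case: xgetP => [m _ fm|/(_ l)/(_ fl)//]; exact: is_deriv_on_unique fm fl.
Qed.

Lemma is_deriv_on_continuous (R : realType) (V : normedModType R) (A : set R)
    (f : R -> V) (df : R -> V) :
  (forall t, A t -> is_deriv_on A f t (df t)) -> {within A, continuous f}.
Proof.
move=> fl; apply/within_continuousP => t At eps eps0.
have /is_deriv_onP/(_ _ ltr01)[d d0 dP] := fl _ At.
have K0 : 0 < 1 + `|df t| by rewrite ltr_wpDr.
exists (Num.min d (eps / (1 + `|df t|))).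
  by rewrite lt_min d0 divr_gt0.
move=> s As; rewrite lt_min => /andP[sd sK].
have := dP _ sd; rewrite subrKC mul1r => /(_ As) fst.
rewrite -[f s - f t](subrK ((s - t) *: df t)) (le_trans (ler_normD _ _))//.
rewrite normrZ (le_trans (lerD fst (lexx _)))//.
rewrite -[X in X + _]mulr1 -mulrDr.
by rewrite -ler_pdivlMr// ltW.
Qed.

Lemma is_deriv_on_is_derive (R : realType) (A : set R) (f : R -> R) (t l : R) :
  nbhs t A -> is_deriv_on A (f : R -> R^o) t l -> is_derive t 1 f l.
Proof.
move=> /nbhs_ballP[r /= r0 rA] fl.
suff dfl : h^-1 *: ((f \o shift t) h - f t) @[h --> (0 : R)^'] --> (l : R^o).
  by apply: DeriveDef; [apply/cvg_ex; exists l|apply/cvg_lim => //];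
    apply: cvg_trans dfl; apply: near_eq_cvg; apply: nearW => h;
    rewrite /= [h%:A]mulr1.
apply/cvgrPdist_le => eps eps0; move/is_deriv_onP : fl => /(_ _ eps0)[d d0 dP].
apply/nbhs_ballP; exists (Num.min r d); first by rewrite /= lt_min r0 d0.
move=> h; rewrite -ball_normE /ball_ /= sub0r normrN lt_min => /andP[hr hd] h0.
rewrite -(ler_pM2r (_ : 0 < `|h|)) ?normr_gt0// -normrM.
rewrite [X in `|X|](_ : _ = - (f (t + h) - f t - h * l)); last first.
  have E (k a b : R) : k != 0 -> (l - k^-1 * (a - b)) * k = - (a - b - k * l).
    by move=> k0; field.
  by rewrite (addrC t); exact: E.
rewrite normrN; apply: dP => //; apply: rA.
by rewrite -ball_normE /ball_ /= opprD addNKr normrN.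
Qed.

(** * Norms on matrices and the Gronwall inequality *)

Lemma normm_coord (R : realType) m n (A : 'M[R]_(m, n)) i j : `|A i j| <= `|A|.
Proof.
rewrite [leRHS]/Num.Def.normr/= mx_normrE.
by apply/bigmax_geP; right => /=; exists (i, j).
Qed.

Lemma normm_le (R : realType) m n (A : 'M[R]_(m, n)) (c : R) :
  0 <= c -> (forall i j, `|A i j| <= c) -> `|A| <= c.
Proof.
move=> c0 Ac; rewrite [leLHS]/Num.Def.normr/= mx_normrE.
by apply: bigmax_le => //= -[i j] _ /=.
Qed.

Lemma normm_mulmx (R : realType) n (x : 'rV[R]_n) (A : 'M[R]_n) :
  `|x *m A| <= n%:R * `|x| * `|A|.
Proof.
apply: normm_le => [|i j]; first by rewrite !mulr_ge0.
rewrite mxE (le_trans (ler_norm_sum _ _ _))//.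
rewrite (@le_trans _ _ (\sum_(k < n) `|x| * `|A|))//.
  by apply: ler_sum => k _; rewrite normrM ler_pM// normm_coord.
by rewrite sumr_const card_ord -mulrA mulr_natl.
Qed.

Lemma norm_dotv (R : realType) n (x y : 'rV[R]_n) :
  `|dotv x y| <= n%:R * `|x| * `|y|.
Proof.
rewrite (le_trans (ler_norm_sum _ _ _))//.
rewrite (@le_trans _ _ (\sum_(k < n) `|x| * `|y|))//.
  by apply: ler_sum => k _; rewrite normrM ler_pM// normm_coord.
by rewrite sumr_const card_ord -mulrA mulr_natl.
Qed.

Lemma sqr_norm_le_dotv (R : realType) n (x : 'rV[R]_n) : `|x| ^+ 2 <= dotv x x.
Proof.
have x2 i : 0 <= x 0 i * x 0 i by rewrite -expr2 sqr_ge0.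
have d0 : 0 <= dotv x x by apply: sumr_ge0 => i _.
rewrite -(sqr_sqrtr d0) ler_pXn2r ?nnegrE ?sqrtr_ge0//.
apply: normm_le => [|i j]; first exact: sqrtr_ge0.
rewrite ord1 -sqrtr_sqr ler_wsqrtr// /dotv (bigD1 j)//= expr2 lerDl.
exact: sumr_ge0.
Qed.

Lemma cvg_dotv (R : realType) n (T : Type) (F : set_system T) {FF : Filter F}
    (f g : T -> 'rV[R]_n) (a b : 'rV[R]_n) :
  f @ F --> a -> g @ F --> b -> dotv (f x) (g x) @[x --> F] --> dotv a b.
Proof.
have coordP i : continuous (fun x : 'rV[R]_n => x 0 i : R).
  exact: coord_continuous.
move=> fa gb; apply: (@cvg_big R _ +%R 0) => [|i _]; first exact: add_continuous.
by apply: cvgM; [exact: cvg_comp fa (coordP i a)|exact: cvg_comp gb (coordP i b)].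
Qed.

Lemma within_continuous_dotv (R : realType) n (T : topologicalType) (A : set T)
    (f g : T -> 'rV[R]_n) :
  {within A, continuous f} -> {within A, continuous g} ->
  {within A, continuous (fun x => dotv (f x) (g x))}.
Proof.
move=> /subspace_continuousP fc /subspace_continuousP gc.
by apply/subspace_continuousP => x Ax; apply: cvg_dotv; [exact: fc|exact: gc].
Qed.

Lemma is_deriv_on_coord (R : realType) n (A : set R) (X : R -> 'rV[R]_n)
    (t : R) (l : 'rV[R]_n) i :
  is_deriv_on A X t l -> is_deriv_on A (fun s => X s 0 i : R^o) t (l 0 i).
Proof.
move=> /is_deriv_onP Xl; apply/is_deriv_onP => eps /Xl[d d0 dP].
exists d => // h hd Ah; apply: le_trans (dP _ hd Ah).
by apply: le_trans (normm_coord _ 0 i); rewrite !mxE.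
Qed.

(** The norm of X is not differentiable, but the squared Euclidean norm N is,
    and N' <= C N + D for C = 1 + 2 n K ^ 2 and D = 2 n eps ^ 2.  As C >= 1,
    the function (N + D) exp(- C t) is nonincreasing.  The constant G is chosen
    before the curve and the interval, which later gives estimates that are
    uniform in the starting points. *)
Lemma gronwall (R : realType) n (K T : R) :
  exists2 G, 0 < G & forall (S : R) (X dX : R -> 'rV[R]_n) (eps : R),
    S <= T -> 0 <= eps ->
    (forall t, 0 <= t <= S -> is_deriv_on `[0, S] X t (dX t)) ->
    (forall t, 0 <= t <= S -> `|dX t| <= K * `|X t| + eps) ->
    forall t, 0 <= t <= S -> `|X t| <= G * (`|X 0| + eps).
Proof.
pose C : R := 1 + 2 * n%:R * K ^+ 2.
have C1 : 1 <= C by rewrite lerDl mulr_ge0 ?sqr_ge0// mulr_ge0.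
exists (1 + 2 * n%:R * expR (C * T)) => [|S X dX eps ST eps0 Xd dXle t].
  by rewrite ltr_pwDl// !mulr_ge0// expR_ge0.
pose N s := dotv (X s) (X s).
pose D := 2 * n%:R * eps ^+ 2.
have D0 : 0 <= D by rewrite mulr_ge0 ?sqr_ge0// mulr_ge0.
pose phi s := (N s + D) * expR (- (C * s)).
pose dN s := \sum_i 2 * X s 0 i * dX s 0 i.
have Nd s : s \in `]0, S[%R -> is_derive s 1 N (dN s).
  rewrite in_itv /= => /andP[s0 sS].
  have Xid i : is_derive s 1 (fun s => X s 0 i) (dX s 0 i).
    apply: (@is_deriv_on_is_derive _ `[0, S]).
      apply: filterS (near_in_itvoo _ : \forall z \near s, z \in `]0, S[%R).
        by move=> z; exact: subset_itv_oo_cc.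
      by rewrite in_itv /= s0.
    by apply: is_deriv_on_coord; apply: Xd; rewrite !ltW.
  rewrite (_ : N = \sum_(i < n) ((fun s => X s 0 i) * (fun s => X s 0 i))).
    apply: is_derive_eq; apply: eq_bigr => i _.
    by rewrite /GRing.scale /=; ring.
  by apply/funext => z; rewrite fct_sumE.
have dNle s : 0 <= s <= S -> dN s <= C * N s + D.
  move=> sS.
  have dX2 i : dX s 0 i ^+ 2 <= 2 * K ^+ 2 * N s + 2 * eps ^+ 2.
    have := le_trans (normm_coord (dX s) 0 i) (dXle s sS).
    have := sqr_norm_le_dotv (X s); rewrite -/(N s) => XN dXi.
    rewrite -real_normK ?num_real//.
    apply: le_trans (_ : (K * `|X s| + eps) ^+ 2 <= _).
      by rewrite ler_pXn2r ?nnegrE// (le_trans _ dXi).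
    have := sqr_ge0 (K * `|X s| - eps).
    have : K ^+ 2 * `|X s| ^+ 2 <= K ^+ 2 * N s by rewrite ler_wpM2l// sqr_ge0.
    by rewrite sqrrB sqrrD exprMn; lra.
  apply: le_trans (_ : \sum_i (X s 0 i * X s 0 i +
     (2 * K ^+ 2 * N s + 2 * eps ^+ 2)) <= _).
    apply: ler_sum => i _; have := dX2 i; have := sqr_ge0 (X s 0 i - dX s 0 i).
    by rewrite sqrrB !expr2; lra.
  rewrite big_split/= -/(dotv _ _) -/(N s) sumr_const card_ord -mulr_natl.
  by rewrite /C /D; lra.
have phid s : s \in `]0, S[%R ->
    is_derive s 1 phi ((dN s - C * (N s + D)) * expR (- (C * s))).
  move=> /Nd Nds.
  rewrite (_ : phi = (N + cst D) * (expR \o (fun s => - C * s))); last first.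
    by apply/funext => z; rewrite /phi !fctE /= mulNr.
  have Ed : is_derive s 1 (fun s : R => - C * s) (- C).
    rewrite (_ : (fun s => _) = (- C) *: (id : R -> R)) //.
    by apply: is_derive_eq; rewrite -[RHS]mulr1.
  apply: is_derive_eq; rewrite !fctE /GRing.scale /= mulNr addr0.
  by ring.
have phic : {within `[0, S], continuous phi}.
  have Xc : {within `[0, S], continuous X}.
    by apply: (@is_deriv_on_continuous _ _ _ _ dX) => s; rewrite /= in_itv; exact: Xd.
  have Nc := within_continuous_dotv Xc Xc.
  have Ec : {within `[0, S], continuous (fun s => expR (- (C * s)))}.
    apply: continuous_subspaceT => z; apply: continuous_comp.
      by apply: continuousN; apply: mulrl_continuous.
    exact: continuous_expR.
  apply/subspace_continuousP => z Sz; apply: cvgM.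
    apply: cvgD; last exact: cvg_cst.
    by move/subspace_continuousP : Nc; exact.
  by move/subspace_continuousP : Ec; exact.
move=> tS; have /andP[t0 tS'] := tS.
have : phi t <= phi 0.
  apply: (@ler0_derive1_nincr _ phi 0 S) => // s sS.
    by have [] := phid _ sS.
  rewrite derive1E; have [_ ->] := phid _ sS.
  rewrite pmulr_lle0 ?expR_gt0// subr_le0.
  have sS' : 0 <= s <= S by move: sS; rewrite in_itv /= => /andP[/ltW-> /ltW->].
  apply: le_trans (dNle _ sS') _; rewrite mulrDr lerD2l.
  by rewrite ler_peMl.
rewrite /phi mulr0 oppr0 expR0 mulr1 expRN ler_pdivrMr ?expR_gt0// => Nt.
have N0 : N 0 <= n%:R * `|X 0| ^+ 2.
  by rewrite (le_trans (ler_norm _))// (le_trans (norm_dotv _ _))// -mulrA.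
have En : expR (C * t) <= expR (C * T).
  by rewrite ler_expR ler_wpM2l// ?(le_trans ler01)// (le_trans tS').
set E := expR (C * T) in En *; have E0 : 0 <= E by exact: expR_ge0.
set s := `|X 0| + eps; have s0 : 0 <= s by rewrite addr_ge0.
have Xs : N 0 + D <= 2 * n%:R * s ^+ 2.
  apply: le_trans (_ : 2 * n%:R * (`|X 0| ^+ 2 + eps ^+ 2) <= _).
    have : 0 <= n%:R * `|X 0| ^+ 2 by rewrite mulr_ge0// sqr_ge0.
    by rewrite /D; lra.
  rewrite ler_wpM2l ?mulr_ge0// sqrrD.
  have : 0 <= `|X 0| * eps by rewrite mulr_ge0.
  by lra.
rewrite -(@ler_pXn2r _ 2) ?nnegrE ?mulr_ge0 ?addr_ge0 ?mulr_ge0//.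
apply: le_trans (sqr_norm_le_dotv _) _; rewrite -/(N t).
apply: le_trans (_ : 2 * n%:R * s ^+ 2 * E <= _).
  apply: le_trans (_ : (N 0 + D) * expR (C * t) <= _).
    by apply: le_trans Nt; rewrite lerDl.
  rewrite ler_pM ?expR_ge0//.
  by rewrite addr_ge0// sumr_ge0// => i _; rewrite -expr2 sqr_ge0.
rewrite exprMn mulrAC ler_wpM2r ?sqr_ge0//.
have : 0 <= 2 * n%:R * E by rewrite !mulr_ge0.
set a := _ * E => a0; rewrite sqrrD expr1n.
have : 0 <= a ^+ 2 by rewrite sqr_ge0.
lra.
Qed.

(** * Compactness of the simplex and the mean value theorem *)

(** The compactness is used in the form of the covering property: a modulus
    that works near each point, for all small d, works on all of K for all
    small d. *)
Lemma compact_uniform_continuity (R : realType) (V W : normedModType R)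
    (K : set V) (f : V -> W) :
  compact K -> {within K, continuous f} ->
  forall eps, 0 < eps -> exists2 d, 0 < d &
    forall x y, K x -> K y -> `|y - x| < d -> `|f y - f x| <= eps.
Proof.
move=> /compact_near_coveringP/near_covering_withinP Kc /within_continuousP fc.
move=> eps eps0.
have : \forall d \near 0^'+,
    K `<=` (fun x => forall y, K y -> `|y - x| < d -> `|f y - f x| <= eps).
  apply: Kc => x Kx; have [r r0 rP] := fc x Kx _ (divr_gt0 eps0 (ltr0Sn R 1)).
  exists (ball x (r / 2), [set d : R | d < r / 2]).
    split; first by apply: nbhsx_ballx; rewrite divr_gt0.
    by apply: nbhs_right_lt; rewrite divr_gt0.
  move=> [x' d] [] /=; rewrite -ball_normE /ball_ /= => xx' dr Kx' y Ky yx'.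
  have x'x : `|x' - x| < r / 2 by rewrite distrC.
  have fx' : `|f x' - f x| <= eps / 2 by apply: rP => //; lra.
  have fy : `|f y - f x| <= eps / 2.
    apply: rP => //; rewrite -(subrKA x') (le_lt_trans (ler_normD _ _))//.
    by lra.
  rewrite -(subrKA (f x)) (le_trans (ler_normD _ _))// (distrC (f x)).
  by lra.
move=> dP.
have [d [d0 dK]] : exists d : R, 0 < d /\
    K `<=` (fun x => forall y, K y -> `|y - x| < d -> `|f y - f x| <= eps).
  near (0 : R)^'+ => d; exists d.
  by split; near: d; [exact: nbhs_right_gt|exact: dP].
by exists d => // x y Kx; exact: dK.
Unshelve. all: by end_near. Qed.

Lemma is_deriv_on_mean_value (R : realType) (f df : R -> R) (a b : R) :
  a < b ->
  (forall t, a <= t <= b -> is_deriv_on `[a, b] (f : R -> R^o) t (df t)) ->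
  exists2 c, a < c < b & f b - f a = df c * (b - a).
Proof.
move=> ab fd.
have [||c] := @MVT _ f df a b ab; last by rewrite in_itv; exists c.
  move=> x; rewrite in_itv /= => /andP[ax xb].
  apply: (@is_deriv_on_is_derive _ `[a, b]).
    apply: filterS (near_in_itvoo _ : \forall z \near x, z \in `]a, b[%R).
      by move=> z; exact: subset_itv_oo_cc.
    by rewrite in_itv /= ax.
  by apply: fd; rewrite !ltW.
apply: (@is_deriv_on_continuous _ R^o _ f df) => t.
by rewrite /= in_itv; exact: fd.
Qed.

Lemma simplex_segment (R : realType) n (a b : 'rV[R]_n) (s : R) :
  0 <= s <= 1 -> simplex a -> simplex b -> simplex ((1 - s) *: a + s *: b).
Proof.
move=> /andP[s0 s1] [a1 a0] [b1 b0]; split=> [|i]; last first.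
  by rewrite !mxE addr_ge0// mulr_ge0// subr_ge0.
under eq_bigr do rewrite !mxE.
by rewrite big_split /= -!mulr_sumr a1 b1 !mulr1 subrK.
Qed.

Lemma simplex_le1 (R : realType) n (a : 'rV[R]_n) i : simplex a -> a 0 i <= 1.
Proof.
move=> [<- a0]; rewrite (bigD1 i)//= lerDl.
by apply: sumr_ge0 => j _.
Qed.

Lemma norm_simplexB_le1 (R : realType) n (a b : 'rV[R]_n) :
  simplex a -> simplex b -> `|b - a| <= 1.
Proof.
move=> Sa Sb; apply: normm_le => // i j; rewrite ord1 !mxE ler_norml.
have [[_ a0] [_ b0]] := (Sa, Sb).
have := (a0 j, b0 j, simplex_le1 j Sa, simplex_le1 j Sb).
by move=> [[[? ?] ?] ?]; apply/andP; split; lra.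
Qed.

Lemma compact_box (R : realType) n (c : R) :
  compact [set x : 'rV[R]_n | forall i, 0 <= x 0 i <= c].
Proof.
rewrite (_ : mkset _ = [set v : 'rV[R]_n | forall i, `[0, c]%classic (v ord0 i)]).
  by apply: (@rV_compact R n (fun=> `[0, c]%classic)) => _; exact: segment_compact.
by apply/seteqP; split=> x /= xP i; have := xP i; rewrite in_itv.
Qed.

Lemma simplex_compact (R : realType) n : compact (@simplex R n).
Proof.
have coordP i : continuous (fun x : 'rV[R]_n => x 0 i : R).
  exact: coord_continuous.
apply: (@subclosed_compact _ _ [set x : 'rV[R]_n | forall i, 0 <= x 0 i <= 1]);
  [|exact: compact_box|]; last first.
  by move=> x Sx i; rewrite simplex_le1// andbT; case: Sx.
rewrite (_ : @simplex R n = [set x : 'rV[R]_n | \sum_i x 0 i = 1] `&`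
    \bigcap_(i in setT) [set x : 'rV[R]_n | 0 <= x 0 i]); last first.
  by apply/seteqP; split=> x /= [x1 x0]; split=> // i *; apply: (x0 i).
apply: closedI.
  apply: (@closed_comp _ _ (fun x : 'rV[R]_n => \sum_i x 0 i) [set 1]).
    move=> x _; apply: (@continuous_big R _ +%R 0) => // i.
    exact: add_continuous.
  exact: closed_eq.
apply: closed_bigI => i _.
by apply: (@closed_comp _ _ (fun x : 'rV[R]_n => x 0 i) [set y | 0 <= y]);
  [move=> x _; exact: coordP|exact: closed_ge].
Qed.

(** * First-order expansion of functions on the simplex *)

Lemma dotvDr (R : realType) n (x y z : 'rV[R]_n) :
  dotv x (y + z) = dotv x y + dotv x z.
Proof. by rewrite /dotv -big_split; apply: eq_bigr => i _; rewrite mxE mulrDr. Qed.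

Lemma dotvZr (R : realType) n (a : R) (x y : 'rV[R]_n) :
  dotv x (a *: y) = a * dotv x y.
Proof. by rewrite /dotv mulr_sumr; apply: eq_bigr => i _; rewrite mxE mulrCA. Qed.

Lemma dotvBr (R : realType) n (x y z : 'rV[R]_n) :
  dotv x (y - z) = dotv x y - dotv x z.
Proof. by rewrite -scaleN1r dotvDr dotvZr mulN1r. Qed.

Lemma dotvBl (R : realType) n (x y z : 'rV[R]_n) :
  dotv (x - y) z = dotv x z - dotv y z.
Proof. by rewrite /dotv -sumrB; apply: eq_bigr => i _; rewrite !mxE mulrBl. Qed.

Lemma dotv_sumr (R : realType) n (I : finType) (x : 'rV[R]_n) (y : I -> 'rV[R]_n) :
  dotv x (\sum_i y i) = \sum_i dotv x (y i).
Proof.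
rewrite /dotv exchange_big; apply: eq_bigr => i _.
by rewrite summxE mulr_sumr.
Qed.

Lemma segmentE (R : realType) n (a b : 'rV[R]_n) (s : R) :
  (1 - s) *: a + s *: b = a + s *: (b - a).
Proof. by rewrite scalerBl scale1r scalerBr addrA addrAC. Qed.

(** A Frechet derivative is a family of one-sided or two-sided derivatives at
    parameter 0 along segments, so that the results on relative derivatives
    apply. *)
Lemma is_frechetP (R : realType) n (F : 'rV[R]_n -> R) (rho f : 'rV[R]_n) :
  is_frechet F rho f <->
  \sum_i f 0 i = 0 /\ forall rho', simplex rho' ->
    is_deriv_on [set t | simplex ((1 - t) *: rho + t *: rho')]
      (fun t => F ((1 - t) *: rho + t *: rho') : R^o) 0 (dotv f (rho' - rho)).
Proof.
suff E rho' :
    (h^-1 *: (F ((1 - (0 + h)) *: rho + (0 + h) *: rho')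
         - F ((1 - 0) *: rho + 0 *: rho') : R^o)
      @[h --> within [set h | simplex ((1 - (0 + h)) *: rho + (0 + h) *: rho')] 0^']) =
    ((F ((1 - t) *: rho + t *: rho') - F rho) / t
      @[t --> within [set t | simplex ((1 - t) *: rho + t *: rho')] 0^']).
  by rewrite /is_frechet /is_deriv_on /=; split=> -[f0 fd]; split=> // rho' Srho';
    have := fd _ Srho'; rewrite E.
rewrite (_ : [set h | simplex ((1 - (0 + h)) *: rho + _)] =
             [set t | simplex ((1 - t) *: rho + t *: rho')]); last first.
  by apply/seteqP; split=> h /=; rewrite add0r.
under eq_fun do rewrite add0r subr0 scale1r scale0r addr0.
by under [in RHS]eq_fun do rewrite mulrC.
Qed.

Lemma vertex_simplex (R : realType) n (i : 'I_n) : simplex (delta_mx 0 i : 'rV[R]_n).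
Proof.
split=> [|j]; last by rewrite mxE eqxx /= ler0n.
rewrite (bigD1 i)//= mxE !eqxx big1 ?addr0// => j ji.
by rewrite mxE (negbTE ji) andbF.
Qed.

Lemma dotv_delta (R : realType) n (x : 'rV[R]_n) i : dotv x (delta_mx 0 i) = x 0 i.
Proof.
rewrite /dotv (bigD1 i)//= mxE !eqxx mulr1 big1 ?addr0// => j ji.
by rewrite mxE (negbTE ji) andbF mulr0.
Qed.

Lemma simplex_increment_proper (R : realType) n (a b : 'rV[R]_n) :
  simplex a -> simplex b ->
  ProperFilter (within [set t | simplex ((1 - t) *: a + t *: b)] 0^').
Proof.
move=> Sa Sb; apply: within_dnbhs0_proper => d d0.
pose m := Num.min (d / 2) 1.
have m0 : 0 < m by rewrite lt_min divr_gt0/=.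
have [md m1] : m <= d / 2 /\ m <= 1 by split; rewrite ge_min lexx ?orbT.
exists m; first by rewrite gt_eqF// gtr0_norm//; split=> //; lra.
by apply: simplex_segment => //; rewrite ltW.
Qed.

(** The directions from rho to the vertices determine f up to a constant
    vector, and the constant is fixed by the normalization. *)
Lemma frechetE (R : realType) n (F : 'rV[R]_n -> R) (rho f : 'rV[R]_n) :
  simplex rho -> is_frechet F rho f -> frechet F rho = f.
Proof.
move=> Srho Ff; rewrite /frechet; case: xgetP => [g _ Fg|/(_ f)/(_ Ff)//].
have [[f0 fd] [g0 gd]] := (Ff, Fg).
have E i : g 0 i - f 0 i = dotv g rho - dotv f rho.
  have Si := @vertex_simplex R n i.
  have FF := simplex_increment_proper Srho Si.
  have : dotv g ('e_i - rho) = dotv f ('e_i - rho).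
    by apply: cvg_unique (gd _ Si) (fd _ Si); exact: norm_hausdorff.
  by rewrite !dotvBr !dotv_delta; lra.
have : \sum_i (g 0 i - f 0 i) = 0 by rewrite sumrB f0 g0 subrr.
under eq_bigr do rewrite E.
rewrite sumr_const card_ord => /eqP; rewrite mulrn_eq0 => /orP[/eqP n0|/eqP c0].
  by apply/rowP => -[i iltn]; exfalso; move: iltn; rewrite n0.
by apply/rowP => i; apply/eqP; rewrite -subr_eq0 E c0.
Qed.

Lemma frechet_derivableP (R : realType) n (F : 'rV[R]_n -> R) (rho : 'rV[R]_n) :
  frechet_derivable F rho -> is_frechet F rho (frechet F rho).
Proof.
by move=> [f Ff]; apply: (@xgetPex _ 0 [set f | is_frechet F rho f]); exists f.
Qed.

(** Moving the base point along the segment from a to b rescales the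
    parameter: from c = (1 - s) a + s b one sees b in direction
    (1 - s) (b - a), and a in direction s (a - b). *)
Lemma frechet_segment (R : realType) n (F : 'rV[R]_n -> R) (a b : 'rV[R]_n)
    (s : R) :
  simplex a -> simplex b -> 0 <= s <= 1 ->
  frechet_derivable F ((1 - s) *: a + s *: b) ->
  is_deriv_on `[0, 1] (fun s => F ((1 - s) *: a + s *: b) : R^o) s
    (dotv (frechet F ((1 - s) *: a + s *: b)) (b - a)).
Proof.
move=> Sa Sb s01 /frechet_derivableP/is_frechetP[_ Fd].
have /andP[s0 s1] := s01; set c := (1 - s) *: a + s *: b in Fd *.
(* The target p is b when s < 1 and a when s = 1. *)
have [p [k [Sp k0 pE]]] :
    exists p k, [/\ simplex p, k != 0 & p - c = k *: (b - a)].
  have [s1'|s1'] := ltP s 1.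
    exists b, (1 - s); split=> //; first by rewrite subr_eq0 gt_eqF.
    by rewrite /c segmentE opprD addrA scalerBl scale1r.
  exists a, (- s); split=> //; first by rewrite oppr_eq0; lra.
  by rewrite /c segmentE opprD addNKr scaleNr.
have {}Fd := Fd _ Sp; apply/is_deriv_onP => eps eps0.
have ek : 0 < eps * `|k| by rewrite mulr_gt0// normr_gt0.
move/is_deriv_onP : Fd => /(_ _ ek)[d d0 dP]; exists (d * `|k|).
  by rewrite mulr_gt0// normr_gt0.
move=> h hd; rewrite /= in_itv /= => sh01.
have := dP (h / k); rewrite normrM normfV ltr_pdivrMr ?normr_gt0// => /(_ hd).
have E : (1 - (s + h)) *: a + (s + h) *: b = (1 - h / k) *: c + (h / k) *: p.
  rewrite [RHS]segmentE pE scalerA divfK// /c !segmentE -addrA -scalerDl.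
  by [].
rewrite add0r /= -E => /(_ (simplex_segment sh01 Sa Sb)).
rewrite subr0 scale1r scale0r addr0 pE dotvZr.
rewrite -[(h / k) *: _]/(h / k * _) mulrA divfK// => /le_trans; apply.
by rewrite -mulrA [`|k| * _]mulrC divfK // normr_eq0.
Qed.

Lemma frechet_mean_value (R : realType) n (F : 'rV[R]_n -> R) (a b : 'rV[R]_n) :
  (forall rho, simplex rho -> frechet_derivable F rho) ->
  simplex a -> simplex b ->
  exists2 s, 0 <= s <= 1 &
    F b - F a = dotv (frechet F ((1 - s) *: a + s *: b)) (b - a).
Proof.
move=> Fd Sa Sb.
have [|s /andP[s0 s1] E] := @is_deriv_on_mean_value R
    (fun s => F ((1 - s) *: a + s *: b))
    (fun s => dotv (frechet F ((1 - s) *: a + s *: b)) (b - a)) 0 1 (@ltr01 R).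
  by move=> s s01; apply: frechet_segment => //; apply: Fd; exact: simplex_segment.
exists s; first by rewrite !ltW.
by move: E; rewrite subrr scale0r add0r scale1r !subr0 scale1r scale0r addr0 mulr1.
Qed.

(** By the mean value theorem the error is the increment of the derivative
    along the segment, and the derivative is uniformly continuous. *)
Lemma frechet_C1_expansion (R : realType) n (F : 'rV[R]_n -> R) :
  frechet_C1 F -> forall eps, 0 < eps -> exists2 d, 0 < d &
    forall a b, simplex a -> simplex b -> `|b - a| < d ->
      `|F b - F a - dotv (frechet F a) (b - a)| <= eps * `|b - a|.
Proof.
move=> [Fd Fc] eps eps0.
have en : 0 < eps / n.+1%:R by rewrite divr_gt0.
have [d d0 dP] := compact_uniform_continuity (@simplex_compact R n) Fc en.
exists d => // a b Sa Sb abd; have [s s01 ->] := frechet_mean_value Fd Sa Sb.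
rewrite -dotvBl (le_trans (norm_dotv _ _))// ler_wpM2r//.
have := dP a ((1 - s) *: a + s *: b) Sa (simplex_segment s01 Sa Sb).
rewrite {1}segmentE addrC addKr normrZ => /(_ _)/wrap[].
  have /andP[s0 s1] := s01; rewrite ger0_norm//.
  by apply: le_lt_trans abd; rewrite ler_piMl.
move=> [/(ler_wpM2l (ler0n R n))/le_trans]; apply.
by rewrite mulrCA ler_piMr ?(ltW eps0)// ler_pdivrMr// mul1r ler_nat.
Qed.

Lemma frechet_C1_continuous (R : realType) n (F : 'rV[R]_n -> R) :
  frechet_C1 F -> {within @simplex R n, continuous F}.
Proof.
move=> FC; apply/(@within_continuousP _ _ R^o) => a Sa eps eps0.
have [d d0 dP] := frechet_C1_expansion FC (@ltr01 R).
pose K := 1 + n%:R * `|frechet F a|.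
have K0 : 0 < K by rewrite ltr_pwDl// mulr_ge0.
exists (Num.min d (eps / K)) => [|b Sb]; first by rewrite lt_min d0 divr_gt0.
rewrite lt_min ltr_pdivlMr// => /andP[bd bK].
rewrite -[F b - F a](subrK (dotv (frechet F a) (b - a))).
rewrite (le_trans (ler_normD _ _))// (le_trans _ (ltW bK))// mulrDr.
apply: lerD; first by rewrite mulrC; exact: dP.
by rewrite mulrC; exact: norm_dotv.
Qed.

(** * First-order expansion of vector fields on the orthant *)

Lemma lipschitz_onP (R : realType) (V W : normedModType R) (A : set V)
    (f : V -> W) :
  [lipschitz f x | x in A] ->
  exists2 K, 0 < K & forall x y, A x -> A y -> `|f y - f x| <= K * `|y - x|.
Proof.
move=> fL.
have [K [K0 KP]] : exists K : R, 0 < K /\ K.-lipschitz_A f.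
  near (pinfty_nbhs R) => K; exists K.
  by split; near: K; [exact: nbhs_pinfty_gt|exact: fL].
by exists K => // x y Ax Ay; have := KP (y, x); apply; split.
Unshelve. all: by end_near. Qed.

Lemma lipschitz_within_continuous (R : realType) (V W : normedModType R)
    (A : set V) (f : V -> W) (K : R) :
  0 < K -> (forall x y, A x -> A y -> `|f y - f x| <= K * `|y - x|) ->
  {within A, continuous f}.
Proof.
move=> K0 fK; apply/within_continuousP => x Ax eps eps0.
exists (eps / K) => [|y Ay]; first by rewrite divr_gt0.
by rewrite ltr_pdivlMr// mulrC => /ltW; apply: le_trans; exact: fK.
Qed.

Lemma sub_simplex_orthant (R : realType) n : @simplex R n `<=` @orthant R n.
Proof. by move=> x []. Qed.

Lemma within_continuous_simplex_bounded (R : realType) n (W : normedModType R)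
    (f : 'rV[R]_n -> W) :
  {within @simplex R n, continuous f} ->
  exists2 M, 0 < M & forall a, simplex a -> `|f a| <= M.
Proof.
move=> fc; have := compact_bounded (continuous_compact fc (@simplex_compact R n)).
move=> fb.
have [M [M0 MP]] : exists M : R, 0 < M /\
    forall y, (f @` @simplex R n) y -> `|y| <= M.
  near (pinfty_nbhs R) => M; exists M.
  by split; near: M; [exact: nbhs_pinfty_gt|exact: fb].
by exists M => // a Sa; apply: MP; exists a.
Unshelve. all: by end_near. Qed.

(** The mean value theorem for one coordinate only: the intermediate point
    depends on i. *)
Lemma differentiable_mean_value (R : realType) n (f : 'rV[R]_n -> 'rV[R]_n)
    (a b : 'rV[R]_n) (i : 'I_n) :
  (forall s, 0 <= s <= 1 -> differentiable f (a + s *: (b - a))) ->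
  exists2 s, 0 <= s <= 1 & f b 0 i - f a 0 i =
    ((b - a) *m 'J f (a + s *: (b - a))) 0 i.
Proof.
move=> fd.
have [|s /andP[s0 s1] E] := @is_deriv_on_mean_value R
    (fun s => f (a + s *: (b - a)) 0 i)
    (fun s => ((b - a) *m 'J f (a + s *: (b - a))) 0 i) 0 1 (@ltr01 R).
  move=> s /fd /[dup] fds /deriveEjacobian <-.
  apply: (@is_deriv_on_coord R n _ (fun s => f (a + s *: (b - a)))).
  have /cvg_ex[/= l fl] : derivable f (a + s *: (b - a)) (b - a).
    exact: diff_derivable.
  have -> : 'D_(b - a) f (a + s *: (b - a)) = l by exact: cvg_lim fl.
  apply/is_deriv_onP => eps eps0.
  have := fl => /cvgrPdist_le /(_ _ eps0) /nbhs_ballP[d /= d0 dP].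
  exists d => // h hd _; have [->|h0] := eqVneq h 0.
    by rewrite addr0 subrr scale0r subr0 !normr0 mulr0.
  have := dP h; rewrite -ball_normE /ball_ /= sub0r normrN => /(_ hd h0).
  rewrite -(ler_pM2r (_ : 0 < `|h|)) ?normr_gt0// mulrC -normrZ.
  rewrite scalerBr scalerA divff// scale1r distrC.
  have -> : a + (s + h) *: (b - a) = h *: (b - a) + (a + s *: (b - a)).
    by rewrite scalerDl addrA addrC.
  by [].
exists s; first by rewrite !ltW.
by move: E; rewrite scale0r addr0 scale1r subrKC subr0 mulr1.
Qed.

(** On the boundary the mean value theorem is not available, so the segment is
    first pushed inside the orthant by a vector with all coordinates delta,
    with delta tending to 0 at the end. *)
Lemma C1_orthant_expansion (R : realType) n (f : 'rV[R]_n -> 'rV[R]_n) :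
  {within @orthant R n, continuous f} -> C1_orthant f ->
  exists2 J : 'rV[R]_n -> 'M[R]_n, {within @simplex R n, continuous J} &
    forall eps, 0 < eps -> exists2 d, 0 < d &
      forall a b, simplex a -> simplex b -> `|b - a| < d ->
        `|f b - f a - (b - a) *m J a| <= eps * `|b - a|.
Proof.
move=> /within_continuousP fc [J [Jc fJ]]; exists J.
  exact: continuous_subspaceW (@sub_simplex_orthant R n) Jc.
move=> eps eps0.
have en : 0 < eps / n.+1%:R by rewrite divr_gt0.
pose B := [set x : 'rV[R]_n | forall i, 0 <= x 0 i <= 2].
have BO : B `<=` @orthant R n by move=> x Bx i; have /andP[] := Bx i.
have Bc : compact B := @compact_box R n 2.
have [d d0 dP] := compact_uniform_continuity Bc (continuous_subspaceW BO Jc) en.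
exists (d / 2) => [|a b Sa Sb abd]; first by rewrite divr_gt0.
apply/ler_addgt0Pr => eta eta0.
have [da da0 daP] := fc a (sub_simplex_orthant Sa) _ (divr_gt0 eta0 (ltr0Sn R 1)).
have [db db0 dbP] := fc b (sub_simplex_orthant Sb) _ (divr_gt0 eta0 (ltr0Sn R 1)).
pose m := Num.min (Num.min da db) (Num.min d 1).
have m0 : 0 < m by rewrite !lt_min da0 db0 d0 ltr01.
have mle : [/\ m <= da, m <= db, m <= d & m <= 1].
  by rewrite /m; split; rewrite !ge_min ?lexx ?orbT.
move: m m0 mle => m m0 [mda mdb md m1].
pose del := m / 2; have del0 : 0 < del by rewrite divr_gt0.
have [delda deldb deld del1] : [/\ del < da, del < db, del <= d / 2 & del < 1].
  by rewrite /del; split; lra.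
pose v : 'rV[R]_n := const_mx del.
have nv : `|v| <= del by apply: normm_le => [|i j]; rewrite ?mxE ?gtr0_norm// ltW.
have pos x : simplex x -> open_orthant (x + v).
  by move=> [_ x0] i; rewrite !mxE ltr_wpDl.
have av : `|f (a + v) - f a| <= eta / 2.
  apply: daP; first by move=> i; rewrite ltW// pos.
  by rewrite addrC addKr (le_lt_trans nv).
have bv : `|f (b + v) - f b| <= eta / 2.
  apply: dbP; first by move=> i; rewrite ltW// pos.
  by rewrite addrC addKr (le_lt_trans nv).
have bav : b + v - (a + v) = b - a by rewrite opprD addrACA subrr addr0.
have segE s : a + v + s *: (b + v - (a + v)) = ((1 - s) *: a + s *: b) + v.
  by rewrite bav segmentE addrAC.
have main : `|f (b + v) - f (a + v) - (b - a) *m J a| <= eps * `|b - a|.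
  apply: normm_le => [|i j]; first by rewrite mulr_ge0// ltW.
  have [s s01|s s01 E] := @differentiable_mean_value R n f (a + v) (b + v) j.
    by rewrite segE; have [] := fJ _ (pos _ (simplex_segment s01 Sa Sb)).
  have Sc := simplex_segment s01 Sa Sb; move: E; rewrite segE.
  have [_ ->] := fJ _ (pos _ Sc).
  rewrite bav ord1 => E.
  have -> : (f (b + v) - f (a + v) - (b - a) *m J a) 0 j =
      ((b - a) *m (J ((1 - s) *: a + s *: b + v) - J a)) 0 j.
    by rewrite mulmxBr; move: E; rewrite !mxE => ->.
  have JJ : `|J ((1 - s) *: a + s *: b + v) - J a| <= eps / n.+1%:R.
    have box x : simplex x -> forall u, 0 <= u < 1 -> B (x + const_mx u).
      move=> Sx u /andP[u0 u1] k; have := simplex_le1 k Sx; rewrite !mxE.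
      by have [_ /(_ k)] := Sx; move=> *; apply/andP; split; lra.
    apply: dP; first by have := box a Sa 0; rewrite addr0; apply; rewrite lexx ltr01.
      by apply: box => //; rewrite ltW.
    rewrite segmentE addrAC [a + _]addrC addrK (le_lt_trans (ler_normD _ _))//.
    have /andP[s0 s1] := s01.
    have : `|s *: (b - a)| <= `|b - a| by rewrite normrZ ger0_norm// ler_piMl.
    by lra.
  apply: le_trans (normm_coord _ 0 j) _.
  apply: le_trans (normm_mulmx _ _) _.
  rewrite -mulrA mulrCA [leRHS]mulrC ler_wpM2l//.
  apply: le_trans (ler_wpM2l (ler0n R n) JJ) _.
  by rewrite mulrCA ler_piMr ?(ltW eps0)// ler_pdivrMr// mul1r ler_nat.
have -> : f b - f a - (b - a) *m J a = (f (b + v) - f (a + v) - (b - a) *m J a)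
     + ((f (a + v) - f a) - (f (b + v) - f b)).
  by apply/rowP => k; move: ((b - a) *m J a) => z; rewrite !mxE; ring.
apply: le_trans (ler_normD _ _) _; apply: lerD => //.
rewrite (le_trans (ler_normB _ _))//; lra.
Qed.

(** * Space regularity of the flow *)

Definition simplex_flow (R : realType) (n : nat) (T : R)
    (X : 'rV[R]_n -> 'rV[R]_n) (sigma : R -> 'rV[R]_n -> 'rV[R]_n) : Prop :=
  [/\ forall t mu, 0 <= t <= T -> simplex mu -> simplex (sigma t mu),
      forall mu, simplex mu -> sigma 0 mu = mu &
      forall t mu, 0 <= t <= T -> simplex mu ->
        is_deriv_on `[0, T] (sigma ^~ mu) t (X (sigma t mu))].

Definition lipschitz_simplex (R : realType) (n : nat)
    (X : 'rV[R]_n -> 'rV[R]_n) : Prop :=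
  exists2 K, 0 < K &
    forall a b, simplex a -> simplex b -> `|X b - X a| <= K * `|b - a|.

Lemma flow_lipschitz (R : realType) n (T : R) (X : 'rV[R]_n -> 'rV[R]_n) sigma :
  lipschitz_simplex X -> simplex_flow T X sigma ->
  exists2 C, 0 < C & forall t mu nu, 0 <= t <= T -> simplex mu -> simplex nu ->
    `|sigma t nu - sigma t mu| <= C * `|nu - mu|.
Proof.
move=> [K K0 XK] [Ss s0 sd]; have [G G0 GP] := gronwall n K T.
exists G => // t mu nu tT Smu Snu.
have := GP T (fun t => sigma t nu - sigma t mu)
  (fun t => X (sigma t nu) - X (sigma t mu)) 0 (lexx _) (lexx _).
rewrite !s0// addr0; apply=> // s sT; first by apply: is_deriv_onB; exact: sd.
by rewrite addr0; apply: XK; exact: Ss.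
Qed.

(** Both sides solve the same equation on [0, T - s] with the same initial
    value, and the Gronwall inequality with eps = 0 bounds their difference by
    its initial value. *)
Lemma flow_semigroup (R : realType) n (T : R) (X : 'rV[R]_n -> 'rV[R]_n) sigma :
  lipschitz_simplex X -> simplex_flow T X sigma ->
  forall s t mu, 0 <= s -> 0 <= t -> t + s <= T -> simplex mu ->
    sigma (t + s) mu = sigma t (sigma s mu).
Proof.
move=> [K K0 XK] [Ss s0 sd] s t mu hs ht tsT Smu.
have [G G0 GP] := gronwall n K T.
have sT : 0 <= s <= T by rewrite hs (le_trans _ tsT)// lerDr.
have Sk := Ss _ _ sT Smu.
have Tr r : 0 <= r <= T - s -> (0 <= r + s <= T) /\ (0 <= r <= T).
  by move=> /andP[r0 rT]; split; apply/andP; split; lra.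
apply/eqP; rewrite -subr_eq0 -normr_le0.
have := GP (T - s) (fun t => sigma (t + s) mu - sigma t (sigma s mu))
  (fun t => X (sigma (t + s) mu) - X (sigma t (sigma s mu))) 0.
rewrite add0r s0// subrr normr0 addr0 mulr0; apply=> //.
- by rewrite gerBl.
- move=> r /Tr[rsT rT]; apply: is_deriv_onB.
    apply: is_deriv_on_subset (is_deriv_on_shift (sd _ _ rsT Smu)) => h.
    rewrite /= !in_itv /= => /andP[h0 hT]; apply/andP; split; lra.
  apply: is_deriv_on_subset (sd _ _ rT Sk) => h.
  by rewrite /= !in_itv /= => /andP[h0 hT]; apply/andP; split; lra.
- by move=> r /Tr[rsT rT]; rewrite addr0; apply: XK; exact: Ss.
- by rewrite ht/=; lra.
Qed.

(** Continuity in time for fixed mu is enough, since the Lipschitz constant in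
    mu does not depend on the time. *)
Lemma flow_continuous (R : realType) n (T : R) (X : 'rV[R]_n -> 'rV[R]_n) sigma :
  lipschitz_simplex X -> simplex_flow T X sigma ->
  {within `[0, T] `*` @simplex R n,
    continuous (fun p : R * 'rV[R]_n => sigma p.1 p.2)}.
Proof.
move=> XL Fs; have [C C0 CP] := flow_lipschitz XL Fs; have [Ss s0 sd] := Fs.
apply/(@within_continuousP R (R * 'rV[R]_n)%type 'rV[R]_n).
move=> -[t mu] [/= tT Smu] eps eps0.
have : {within `[0, T], continuous (sigma ^~ mu)}.
  apply: (@is_deriv_on_continuous _ _ _ _ (fun t => X (sigma t mu))) => s.
  by rewrite /= in_itv => /= sT; exact: sd.
move=> /within_continuousP/(_ t tT _ (divr_gt0 eps0 (ltr0Sn R 1)))[d d0 dP].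
exists (Num.min d (eps / 2 / C)); first by rewrite lt_min d0 !divr_gt0.
move=> [s nu] [/= sT Snu]; rewrite prod_normE /= gt_max !lt_min.
move=> /andP[/andP[sd' _] /andP[_ nuC]].
rewrite -(subrKA (sigma s mu)) (le_trans (ler_normD _ _))//.
move: nuC; rewrite ltr_pdivlMr// mulrC => nuC.
have sT' : 0 <= s <= T by move: sT; rewrite in_itv.
have := CP _ _ _ sT' Smu Snu; have := dP s sT sd'; lra.
Qed.

(** Differentiability in the space variable on the simplex, uniform in the
    time parameter and in the base point, formulated without the derivative: a
    linear relation between increments of the argument is satisfied up to a
    small error by the increments of the values. *)
Definition almost_linear (R : realType) (n : nat) (W : normedModType R) (T : R)
    (F : R -> 'rV[R]_n -> W) : Prop :=
  forall eps, 0 < eps -> exists2 eta, 0 < eta &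
    forall (I : finType) (a : I -> R) (nu : I -> 'rV[R]_n) mu t,
      0 <= t <= T -> simplex mu -> (forall i, simplex (nu i)) ->
      (forall i, `|nu i - mu| < eta) -> \sum_i a i *: (nu i - mu) = 0 ->
      `|\sum_i a i *: (F t (nu i) - F t mu)| <=
        eps * \sum_i `|a i| * `|nu i - mu|.

(** The combination Z of flow increments starts at 0 and solves the linearized
    equation Z' = Z J(sigma) up to a small error, so that it stays small. *)
Lemma flow_almost_linear (R : realType) n (T : R) (X : 'rV[R]_n -> 'rV[R]_n)
    sigma (J : 'rV[R]_n -> 'M[R]_n) :
  lipschitz_simplex X -> simplex_flow T X sigma ->
  {within @simplex R n, continuous J} ->
  (forall eps, 0 < eps -> exists2 d, 0 < d &
    forall a b, simplex a -> simplex b -> `|b - a| < d ->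
      `|X b - X a - (b - a) *m J a| <= eps * `|b - a|) ->
  almost_linear T sigma.
Proof.
move=> XL Fs Jc XJ eps eps0.
have [C C0 CP] := flow_lipschitz XL Fs; have [Ss s0 sd] := Fs.
have [M M0 MP] := within_continuous_simplex_bounded Jc.
have [G G0 GP] := gronwall n (n%:R * M) T.
have e0 : 0 < eps / (G * C) by rewrite divr_gt0// mulr_gt0.
have [d d0 dP] := XJ _ e0; exists (d / C); first by rewrite divr_gt0.
move=> I a nu mu t tT Smu Snu nud rel.
set E := \sum_i _ * _; have E0 : 0 <= E by apply: sumr_ge0 => i _; rewrite mulr_ge0.
have E1 : 0 <= eps / G * E by rewrite mulr_ge0// divr_ge0 ?ltW.
have := GP T (fun t => \sum_i a i *: (sigma t (nu i) - sigma t mu))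
  (fun t => \sum_i a i *: (X (sigma t (nu i)) - X (sigma t mu)))
  (eps / G * E) (lexx _) E1.
under [X in `|X| + _]eq_bigr do rewrite !s0//.
rewrite rel normr0 add0r mulrA mulrCA mulfV ?gt_eqF// mulr1; apply=> // r rT.
  by apply: is_deriv_on_sum => i; apply: is_deriv_onB; exact: sd.
set Z := \sum_i _ *: (sigma _ _ - _).
have -> : \sum_i a i *: (X (sigma r (nu i)) - X (sigma r mu)) =
    Z *m J (sigma r mu) + \sum_i a i *: (X (sigma r (nu i)) - X (sigma r mu)
      - (sigma r (nu i) - sigma r mu) *m J (sigma r mu)).
  rewrite /Z mulmx_suml -big_split /=; apply: eq_bigr => i _.
  by rewrite -scalemxAl -scalerDr subrKC.
rewrite (le_trans (ler_normD _ _))// lerD//.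
  rewrite (le_trans (normm_mulmx _ _))// mulrAC ler_wpM2r//.
  by rewrite ler_wpM2l//; apply: MP; exact: Ss.
rewrite (le_trans (ler_norm_sum _ _ _))// /E mulr_sumr; apply: ler_sum => i _.
rewrite normrZ mulrCA ler_wpM2l//.
have sC := CP _ _ _ rT Smu (Snu i).
have lt_d : `|sigma r (nu i) - sigma r mu| < d.
  by rewrite (le_lt_trans sC)// mulrC -ltr_pdivlMr.
apply: le_trans (dP _ _ (Ss _ _ rT Smu) (Ss _ _ rT (Snu i)) lt_d) _.
apply: le_trans (ler_wpM2l (ltW e0) sC) _.
by rewrite invfM mulrA mulrA divfK ?gt_eqF.
Qed.

(** To first order, the increments of u0 are the images under the linear form
    f of the increments of the flow, and those are almost linear. *)
Lemma frechet_C1_comp_almost_linear (R : realType) n (T : R) (u0 : 'rV[R]_n -> R)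
    (sigma : R -> 'rV[R]_n -> 'rV[R]_n) (C : R) :
  0 < C ->
  (forall t mu nu, 0 <= t <= T -> simplex mu -> simplex nu ->
    `|sigma t nu - sigma t mu| <= C * `|nu - mu|) ->
  (forall t mu, 0 <= t <= T -> simplex mu -> simplex (sigma t mu)) ->
  almost_linear T sigma -> frechet_C1 u0 ->
  almost_linear T (fun t mu => u0 (sigma t mu) : R^o).
Proof.
move=> C0 CP Ss sAL u0C eps eps0.
have [B B0 BP] := within_continuous_simplex_bounded u0C.2.
have k0 : 0 < n%:R * B + 1 by rewrite ltr_wpDl// mulr_ge0// ltW.
have e10 : 0 < eps / 2 / (n%:R * B + 1) by rewrite !divr_gt0.
have [eta eta0 etaP] := sAL _ e10.
have e20 : 0 < eps / 2 / C by rewrite !divr_gt0.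
have [d d0 dP] := frechet_C1_expansion u0C e20.
exists (Num.min eta (d / C)); first by rewrite lt_min eta0 divr_gt0.
move=> I a nu mu t tT Smu Snu nulim rel.
have nueta i : `|nu i - mu| < eta by have := nulim i; rewrite lt_min => /andP[].
have nud i : `|nu i - mu| < d / C by have := nulim i; rewrite lt_min => /andP[].
have {etaP} sP := etaP _ _ _ _ _ tT Smu Snu nueta rel.
set E := \sum_i _ * _ in sP *.
have E0 : 0 <= E by apply: sumr_ge0 => i _; rewrite mulr_ge0.
set f := frechet u0 (sigma t mu); have Bf : `|f| <= B := BP _ (Ss _ _ tT Smu).
have -> : \sum_i a i *: (u0 (sigma t (nu i)) - u0 (sigma t mu) : R^o) =
    dotv f (\sum_i a i *: (sigma t (nu i) - sigma t mu)) +
    \sum_i a i * (u0 (sigma t (nu i)) - u0 (sigma t mu)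
      - dotv f (sigma t (nu i) - sigma t mu)).
  rewrite dotv_sumr -big_split /=; apply: eq_bigr => i _.
  by rewrite dotvZr -mulrDr subrKC.
rewrite (le_trans (ler_normD _ _))// [eps](splitr eps) mulrDl lerD//.
  rewrite (le_trans (norm_dotv _ _))//.
  apply: le_trans (_ : (n%:R * B + 1) * (eps / 2 / (n%:R * B + 1) * E) <= _).
    rewrite ler_pM ?mulr_ge0//.
    by rewrite (le_trans (ler_wpM2l (ler0n R n) Bf))// lerDl.
  by rewrite mulrA mulrCA divff ?gt_eqF// mulr1.
rewrite (le_trans (ler_norm_sum _ _ _))// /E mulr_sumr; apply: ler_sum => i _.
rewrite normrM mulrCA ler_wpM2l//.
have sC := CP _ _ _ tT Smu (Snu i).
have lt_d : `|sigma t (nu i) - sigma t mu| < d.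
  by rewrite (le_lt_trans sC)// mulrC -ltr_pdivlMr.
apply: le_trans (dP _ _ (Ss _ _ tT Smu) (Ss _ _ tT (Snu i)) lt_d) _.
apply: le_trans (ler_wpM2l (ltW e20) sC) _.
by rewrite mulrA divfK ?gt_eqF.
Qed.

(** * From almost linearity to Frechet derivatives *)

Definition segment_quotient (R : realType) n (F : 'rV[R]_n -> R)
    (mu rho : 'rV[R]_n) (h : R) : R :=
  h^-1 * (F ((1 - h) *: mu + h *: rho) - F mu).

Definition vertex_quotient (R : realType) n (F : 'rV[R]_n -> R)
    (mu : 'rV[R]_n) (s : R) : 'rV[R]_n :=
  \row_i segment_quotient F mu (delta_mx 0 i) s.

(** Since rho - mu is the average, with weights rho, of the directions from mu
    to the vertices, there is a linear relation between the increment of size h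
    towards rho and those of size s towards the vertices; almost linearity
    turns it into this estimate. *)
Lemma segment_quotient_vertices (R : realType) n (T : R)
    (F : R -> 'rV[R]_n -> R) :
  almost_linear T (fun t mu => F t mu : R^o) ->
  forall eps, 0 < eps -> exists2 eta, 0 < eta <= 1 &
    forall t mu rho h s, 0 <= t <= T -> simplex mu -> simplex rho ->
      simplex ((1 - h) *: mu + h *: rho) -> h != 0 -> `|h| < eta ->
      0 < s < eta ->
      `|segment_quotient (F t) mu rho h
        - dotv (vertex_quotient (F t) mu s) rho| <= eps.
Proof.
move=> FAL eps eps0; have [eta eta0 etaP] := FAL _ (divr_gt0 eps0 (ltr0Sn R 1)).
exists (Num.min eta 1); first by rewrite lt_min eta0 ltr01 ge_min lexx orbT.
move=> t mu rho h s tT Smu Srho Sh h0; rewrite !lt_min.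
move=> /andP[heta _] /and3P[s0 seta s1].
(* The left summand of the index type is the increment towards rho. *)
pose a (k : 'I_1 + 'I_n) := if k is inr i then - (rho 0 i / s) else h^-1.
pose nu (k : 'I_1 + 'I_n) : 'rV[R]_n := if k is inr i
  then (1 - s) *: mu + s *: delta_mx 0 i else (1 - h) *: mu + h *: rho.
have Snu k : simplex (nu k).
  case: k => [_//|i] /=; apply: simplex_segment => //; last exact: vertex_simplex.
  by rewrite !ltW.
have nuB k : nu k - mu = if k is inr i then s *: (delta_mx 0 i - mu)
    else h *: (rho - mu).
  by case: k => [_|i] /=; rewrite segmentE addrC addKr.
have nule k : `|nu k - mu| <= if k is inr i then s else `|h|.
  rewrite nuB; case: k => [_|i]; rewrite normrZ.
    by rewrite ler_piMr// norm_simplexB_le1.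
  rewrite gtr0_norm// ler_piMr ?(ltW s0)//.
  by apply: norm_simplexB_le1 => //; exact: vertex_simplex.
have nulim k : `|nu k - mu| < eta by apply: le_lt_trans (nule k) _; case: k.
have [rho1 rho0] := Srho.
have rel : \sum_k a k *: (nu k - mu) = 0.
  rewrite big_sumType big_ord1 nuB; under eq_bigr do rewrite nuB.
  rewrite /= scalerA mulVf// scale1r.
  under eq_bigr do rewrite scalerA mulNr divfK ?gt_eqF// scaleNr scalerBr.
  rewrite sumrN sumrB -scaler_suml rho1 scale1r -row_sum_delta.
  by rewrite opprB addrC subrKA subrr.
have := etaP _ a nu mu t tT Smu Snu nulim rel.
rewrite !big_sumType !big_ord1 /=.
set A := (X in `|X| <= _); have -> : A = segment_quotient (F t) mu rho h
        - dotv (vertex_quotient (F t) mu s) rho.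
  rewrite /A; congr (_ + _); rewrite /dotv -sumrN; apply: eq_bigr => i _.
  rewrite mxE /segment_quotient /= -[_ *: _]/(_ * _) mulNr; congr (- _).
  by rewrite mulrC mulrA [s^-1 * _]mulrC mulrAC.
move=> /le_trans; apply.
apply: le_trans (_ : eps / 2 * (1 + 1) <= _); last by lra.
rewrite ler_wpM2l ?divr_ge0 ?(ltW eps0)// lerD//.
  rewrite normfV mulrC ler_pdivrMr ?normr_gt0// mul1r.
  exact: (nule (inl 0)).
rewrite -[leRHS]rho1; apply: ler_sum => i _.
rewrite normrN normrM normfV (gtr0_norm s0) ger0_norm//.
rewrite -mulrA ler_piMr// mulrC ler_pdivrMr// mul1r.
exact: (nule (inr i)).
Qed.

(** L is the limit of the vertex quotients as s tends to 0.  It exists because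
    the previous estimate, for rho a vertex, compares two such quotients.
    Passing to the limit in s keeps eta independent of t, mu and rho, so that
    the convergence is uniform. *)
Lemma vertex_quotient_limit (R : realType) n (T : R)
    (F : R -> 'rV[R]_n -> R) :
  almost_linear T (fun t mu => F t mu : R^o) ->
  exists L : R -> 'rV[R]_n -> 'rV[R]_n,
    forall eps, 0 < eps -> exists2 eta, 0 < eta <= 1 &
    forall t mu rho h, 0 <= t <= T -> simplex mu -> simplex rho ->
      simplex ((1 - h) *: mu + h *: rho) -> h != 0 -> `|h| < eta ->
      `|segment_quotient (F t) mu rho h - dotv (L t mu) rho| <= eps.
Proof.
move=> FAL; have Fq := segment_quotient_vertices FAL.
exists (fun t mu => lim (vertex_quotient (F t) mu s @[s --> 0^'+])).
move=> eps eps0; have [eta eta01 etaP] := Fq _ (divr_gt0 eps0 (ltr0Sn R 1)).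
exists eta => // t mu rho h tT Smu Srho Sh h0 heta.
set q := vertex_quotient (F t) mu.
have qc : cvg (q s @[s --> 0^'+]).
  apply/cauchy_cvgP/cauchy_exP => e e0.
  have [k /andP[k0 k1] kP] := Fq _ (divr_gt0 e0 (ltr0Sn R 1)).
  exists (q (k / 2)); suff : \forall s \near 0^'+, ball (q (k / 2)) e (q s) by [].
  near=> s; have s0 : 0 < s by near: s; exact: nbhs_right_gt.
  have sk : s < k by near: s; exact: nbhs_right_lt.
  rewrite /= -ball_normE /ball_ /= distrC; apply: le_lt_trans (_ : e / 2 < _); last lra.
  apply: normm_le => [|i j]; first by rewrite ltW// divr_gt0.
  rewrite ord1 !mxE.
  have Sj := @vertex_simplex R n j.
  have := kP t mu (delta_mx 0 j) s (k / 2) tT Smu Sj.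
  rewrite dotv_delta mxE; apply.
  - by apply: simplex_segment => //; apply/andP; split; lra.
  - by rewrite gt_eqF.
  - by rewrite gtr0_norm.
  - by apply/andP; split; lra.
have en : 0 < eps / 2 / n.+1%:R by rewrite !divr_gt0.
have /cvgrPdist_le /(_ _ en) qL := qc.
have [s [s0 seta sL]] : exists s, [/\ 0 < s, s < eta &
    `|lim (q s @[s --> 0^'+]) - q s| <= eps / 2 / n.+1%:R].
  near (0 : R)^'+ => s; exists s; split; near: s; [exact: nbhs_right_gt| |exact: qL].
  by apply: nbhs_right_lt; case/andP: eta01.
set L := lim _ in sL *.
have -> : segment_quotient (F t) mu rho h - dotv L rho =
   (segment_quotient (F t) mu rho h - dotv (q s) rho) - dotv (L - q s) rho.
  by rewrite dotvBl opprB addrA subrK.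
rewrite (le_trans (ler_normB _ _))// [eps]splitr lerD//.
  by apply: etaP => //; rewrite s0.
rewrite (le_trans (norm_dotv _ _))//.
have rho1 : `|rho| <= 1.
  apply: normm_le => // i j; rewrite ord1 ger0_norm ?simplex_le1//.
  by case: Srho.
apply: le_trans (ler_piMr _ rho1) _; first by rewrite mulr_ge0.
apply: le_trans (ler_wpM2l (ler0n R n) sL) _.
rewrite mulrCA ler_piMr ?divr_ge0 ?(ltW eps0)// ler_pdivrMr// mul1r ler_nat.
by [].
Unshelve. all: by end_near. Qed.

(** The representative with zero coordinate sum of a linear form on the
    tangent space of the simplex. *)
Definition sub_mean (R : realType) n (x : 'rV[R]_n) : 'rV[R]_n :=
  x - const_mx (n%:R^-1 * \sum_i x 0 i).

Lemma sum_sub_mean (R : realType) n (x : 'rV[R]_n) : \sum_i sub_mean x 0 i = 0.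
Proof.
case: n x => [|n] x; first by rewrite big_ord0.
under eq_bigr do rewrite !mxE.
rewrite sumrB sumr_const card_ord -mulrnAl -[_ *+ n.+1]mulr_natr mulVf ?pnatr_eq0//.
by rewrite mul1r subrr.
Qed.

Lemma dotv_sub_mean (R : realType) n (x a b : 'rV[R]_n) :
  simplex a -> simplex b -> dotv (sub_mean x) (b - a) = dotv x (b - a).
Proof.
move=> [a1 _] [b1 _]; rewrite dotvBl; move: (_ * _) => k.
suff -> : dotv (const_mx k) (b - a) = 0 by rewrite subr0.
rewrite /dotv; under eq_bigr do rewrite !mxE.
by rewrite -mulr_sumr sumrB a1 b1 subrr mulr0.
Qed.

Lemma norm_sub_meanB (R : realType) n (x y : 'rV[R]_n) :
  `|sub_mean x - sub_mean y| <= 2 * `|x - y|.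
Proof.
have -> : sub_mean x - sub_mean y = (x - y) - const_mx (n%:R^-1 * \sum_i (x - y) 0 i).
  apply/rowP => i; rewrite !mxE; under [in RHS]eq_bigr do rewrite !mxE.
  by rewrite sumrB mulrBr; ring.
rewrite (le_trans (ler_normB _ _))// mulrDl mul1r lerD//.
apply: normm_le => // i j; rewrite mxE normrM normfV normr_nat.
case: n x y i j => [|n] x y i j; first by case: j.
rewrite mulrC ler_pdivrMr// (le_trans (ler_norm_sum _ _ _))//.
apply: le_trans (ler_sum _ (fun k _ => normm_coord (x - y) 0 k)) _.
by rewrite sumr_const card_ord mulr_natr.
Qed.

(** The limit L of the vertex quotients computes the derivative in direction
    rho - mu as L.rho.  The choice rho = mu gives L.mu = 0, so that this is also
    L.(rho - mu), and removing the mean of L restores the normalization. *)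
Lemma almost_linear_frechet (R : realType) n (T : R) (F : R -> 'rV[R]_n -> R) :
  almost_linear T (fun t mu => F t mu : R^o) ->
  {within `[0, T] `*` @simplex R n,
    continuous (fun p : R * 'rV[R]_n => F p.1 p.2)} ->
  (forall t mu, 0 <= t <= T -> simplex mu -> frechet_derivable (F t) mu) /\
  {within `[0, T] `*` @simplex R n,
    continuous (fun p : R * 'rV[R]_n => frechet (F p.1) p.2)}.
Proof.
move=> FAL Fc; have [L LP] := vertex_quotient_limit FAL.
have L0 t mu : 0 <= t <= T -> simplex mu -> dotv (L t mu) mu = 0.
  move=> tT Smu; apply/eqP; rewrite -normr_le0; apply/ler_addgt0Pr => eps eps0.
  rewrite add0r; have [eta /andP[eta0 eta1] etaP] := LP _ eps0.
  have muE : (1 - eta / 2) *: mu + (eta / 2) *: mu = mu.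
    by rewrite -scalerDl subrK scale1r.
  have := etaP t mu mu (eta / 2) tT Smu Smu.
  rewrite /segment_quotient muE subrr mulr0 sub0r normrN; apply=> //.
    by rewrite gt_eqF// divr_gt0.
  by rewrite gtr0_norm ?divr_gt0//; lra.
have Fd t mu : 0 <= t <= T -> simplex mu -> is_frechet (F t) mu (sub_mean (L t mu)).
  move=> tT Smu; split=> [|rho Srho]; first exact: sum_sub_mean.
  rewrite dotv_sub_mean// dotvBr L0// subr0.
  apply/cvgrPdist_le => eps eps0; apply/within_dnbhs0P.
  have [eta /andP[eta0 _] etaP] := LP _ eps0; exists eta => // h h0 heta Sh.
  have := etaP t mu rho h tT Smu Srho Sh h0 heta.
  by rewrite distrC /segment_quotient mulrC.
have FdE t mu : 0 <= t <= T -> simplex mu -> frechet (F t) mu = sub_mean (L t mu).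
  by move=> tT Smu; apply: frechetE => //; exact: Fd.
split=> [t mu tT Smu|]; first by exists (sub_mean (L t mu)); exact: Fd.
move/(@within_continuousP R (R * 'rV[R]_n)%type R^o) : Fc => Fc.
apply/(@within_continuousP R (R * 'rV[R]_n)%type 'rV[R]_n) => -[t mu] [/= tT Smu].
have tT' : 0 <= t <= T by move: tT; rewrite in_itv.
move=> eps eps0; rewrite (FdE _ _ tT' Smu).
have e8 : 0 < eps / 8 by rewrite divr_gt0.
(* The error in each coordinate is at most 4 * (eps / 8): replacing the two
   quotients by their limits, and the increments of F at the two ends of the
   segment divided by s.  Removing the mean doubles it. *)
have [eta /andP[eta0 eta1] etaP] := LP _ e8.
pose s := eta / 2; have s0 : 0 < s by rewrite divr_gt0.
have s1 : s <= 1 by rewrite /s; lra.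
have seta : s < eta by rewrite /s; lra.
have qL t' mu' i : 0 <= t' <= T -> simplex mu' ->
    `|segment_quotient (F t') mu' (delta_mx 0 i) s - L t' mu' 0 i| <= eps / 8.
  move=> t'T Smu'; have Si := @vertex_simplex R n i.
  have := etaP t' mu' (delta_mx 0 i) s t'T Smu' Si.
  rewrite dotv_delta; apply; [|by rewrite gt_eqF|by rewrite gtr0_norm].
  by apply: simplex_segment => //; rewrite ltW.
have e8s : 0 < eps / 8 * s by rewrite mulr_gt0.
have vS mu' i : simplex mu' -> simplex ((1 - s) *: mu' + s *: delta_mx 0 i).
  by move=> Smu'; apply: simplex_segment; rewrite ?(ltW s0) ?s1//; exact: vertex_simplex.
(* The radius of continuity depends on the vertex; D below is the smallest. *)
have dex (i : 'I_n) : exists d, 0 < d /\ forall p : R * 'rV[R]_n,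
    0 <= p.1 <= T -> simplex p.2 -> `|p - (t, mu)| < d ->
    `|F p.1 ((1 - s) *: p.2 + s *: delta_mx 0 i) -
      F t ((1 - s) *: mu + s *: delta_mx 0 i)| <= eps / 8 * s.
  have [//|d d0 dP] := Fc (t, (1 - s) *: mu + s *: delta_mx 0 i) _ _ e8s.
    by split => //=; exact: vS.
  exists d; split=> // -[t' mu'] /= t'T Smu' p.
  apply: (dP (t', (1 - s) *: mu' + s *: delta_mx 0 i)).
    by split; [rewrite /= in_itv|exact: vS].
  apply: le_lt_trans p; rewrite !prod_normE /= ge_max !le_max lexx /=.
  rewrite opprD addrACA subrr addr0 -scalerBr normrZ ger0_norm ?subr_ge0//.
  by rewrite ler_piMl ?orbT//; lra.
have {dex} [d dP] := choice dex.
have [|d0 d00 d0P] := Fc (t, mu) _ _ e8s; first by split.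
pose D := \big[Num.min/d0]_i d i.
have D0 : 0 < D by apply: lt_bigmin => // i _; case: (dP i).
exists D => // -[t' mu'] [/= t'T Smu'] pD.
have t'T' : 0 <= t' <= T by move: t'T; rewrite in_itv.
rewrite (FdE _ _ t'T' Smu') (le_trans (norm_sub_meanB _ _))//.
rewrite -ler_pdivlMl//; apply: normm_le => [|k i].
  by rewrite mulr_ge0 ?invr_ge0 ?ltW.
rewrite {k}ord1 [X in `|X|]mxE [X in _ + X]mxE.
have q1 := qL t mu i tT' Smu; have q2 := qL t' mu' i t'T' Smu'.
have pd : `|(t', mu') - (t, mu)| < d i.
  by rewrite (lt_le_trans pD)// /D bigmin_le_cond.
have pd0 : `|(t', mu') - (t, mu)| < d0.
  by rewrite (lt_le_trans pD)// /D bigmin_le_id.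
have f1 := (dP i).2 (t', mu') t'T' Smu' pd.
have f2 := d0P (t', mu') (conj t'T Smu') pd0.
have f3 : `|segment_quotient (F t') mu' (delta_mx 0 i) s -
    segment_quotient (F t) mu (delta_mx 0 i) s| <= eps / 4.
  rewrite /segment_quotient -mulrBr normrM gtr0_norm ?invr_gt0// ler_pdivrMl//.
  move: f1 f2 => /=; set x1 := F t' (_ + _); set x2 := F t (_ + _) => f1 f2.
  have -> : x1 - F t' mu' - (x2 - F t mu) = (x1 - x2) - (F t' mu' - F t mu) by ring.
  by rewrite (le_trans (ler_normB _ _))//; lra.
move: f3 q1 q2; set y1 := segment_quotient _ _ _ _.
set y2 := segment_quotient _ _ _ _.
rewrite !ler_norml => /andP[? ?] /andP[? ?] /andP[? ?]; apply/andP; split; lra.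
Qed.

(** * Chain rule, summation by parts and the theorem *)

(** The curve stays in the simplex without following a segment, so that the
    definition of the derivative along segments does not apply; the uniform
    expansion does. *)
Lemma frechet_chain_rule (R : realType) n (F : 'rV[R]_n -> R) (A : set R)
    (gamma : R -> 'rV[R]_n) (t : R) (v : 'rV[R]_n) :
  frechet_C1 F -> (forall s, A s -> simplex (gamma s)) -> A t ->
  is_deriv_on A gamma t v ->
  is_deriv_on A (fun s => F (gamma s) : R^o) t (dotv (frechet F (gamma t)) v).
Proof.
move=> FC Sg At gv; apply/is_deriv_onP => eps eps0.
set f := frechet F (gamma t).
have k0 : 0 < 2 * (`|v| + 1) by rewrite mulr_gt0// ltr_wpDl.
have [d1 d10 d1P] := frechet_C1_expansion FC (divr_gt0 eps0 k0).
have m0 : 0 < 2 * (n%:R * `|f| + 1) by rewrite mulr_gt0// ltr_wpDl// mulr_ge0.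
move/is_deriv_onP : gv => gv.
have [d2 d20 d2P] := gv _ (divr_gt0 eps0 m0).
have [d3 d30 d3P] := gv _ (@ltr01 R).
exists (Num.min (d1 / (`|v| + 1)) (Num.min d2 d3)).
  by rewrite !lt_min d20 d30 divr_gt0// ltr_wpDl.
move=> h; rewrite !lt_min => /and3P[hd1 hd2 hd3] Ath.
have gle : `|gamma (t + h) - gamma t| <= (`|v| + 1) * `|h|.
  rewrite -[gamma (t + h) - _](subrK (h *: v)) (le_trans (ler_normD _ _))//.
  by rewrite normrZ mulrDl addrC [`|v| * _]mulrC lerD2l d3P.
have glt : `|gamma (t + h) - gamma t| < d1.
  by apply: le_lt_trans gle _; rewrite mulrC -ltr_pdivlMr// ltr_wpDl.
have -> : F (gamma (t + h)) - F (gamma t) - h *: (dotv f v : R^o) =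
    (F (gamma (t + h)) - F (gamma t) - dotv f (gamma (t + h) - gamma t))
    + dotv f (gamma (t + h) - gamma t - h *: v).
  by rewrite (dotvBr f _ (h *: v)) dotvZr addrA subrK.
rewrite (le_trans (ler_normD _ _))// [eps]splitr mulrDl lerD//.
  apply: le_trans (d1P _ _ (Sg _ At) (Sg _ Ath) glt) _.
  apply: le_trans (ler_wpM2l _ gle) _; first by rewrite divr_ge0// ltW.
  by rewrite mulrA ler_wpM2r// invfM mulrA divfK// gt_eqF// ltr_wpDl//.
rewrite (le_trans (norm_dotv _ _))//.
apply: le_trans
  (_ : (n%:R * `|f| + 1) * (eps / (2 * (n%:R * `|f| + 1)) * `|h|) <= _).
  rewrite ler_pM ?mulr_ge0//; first by rewrite lerDl.
  exact: d2P.
by rewrite mulrA ler_wpM2r// invfM mulrC -!mulrA mulVf ?mulr1// gt_eqF//.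
Qed.

(** When mu is positive, exchanging the two end points of every edge moves the
    discrete gradient from the Frechet derivative to log mu. *)
Lemma ind_noiseE (R : realType) n (e : rel 'I_n) (w : 'M[R]_n)
    (g gb : R -> R -> R) (F : 'rV[R]_n -> R) (mu : 'rV[R]_n) :
  weighted_graph e w -> interpolation g -> log_extension g gb -> simplex mu ->
  ind_noise e w g gb F mu = dotv (frechet F mu) (xi e w gb mu).
Proof.
move=> Hgraph Hg [gbE _] Smu; rewrite /ind_noise; case: ifPn => // /forallP mu0.
set f := frechet F mu.
have mu01 i : 0 <= mu 0 i <= 1 by rewrite simplex_le1// ltW.
have gC i j : g (mu 0 i) (mu 0 j) = g (mu 0 j) (mu 0 i) by exact: interp_sym.
pose a i j := w i j * g (mu 0 i) (mu 0 j) * f 0 i * ln (mu 0 j).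
pose b i j := w i j * g (mu 0 i) (mu 0 j) * f 0 i * ln (mu 0 i).
have w0 i j : e i j -> 0 <= w i j by move=> /(weight_pos Hgraph)/ltW.
transitivity (\sum_i \sum_(j | e i j) (a j i - b i j)).
  apply: eq_bigr => i _; rewrite !mxE mulr_suml; apply: eq_bigr => j ij.
  rewrite !mxE /a /b -/f (weight_sym Hgraph j i) (gC j i).
  rewrite -[w i j in RHS](sqr_sqrtr (w0 _ _ ij)); ring.
transitivity (\sum_i \sum_(j | e i j) (a i j - b i j)).
  have swap : \sum_i \sum_(j | e i j) a j i = \sum_i \sum_(j | e i j) a i j.
    rewrite (exchange_big_dep xpredT)//=; apply: eq_bigr => j _.
    by apply: eq_bigl => i; rewrite (edge_sym Hgraph).
  by under eq_bigr do rewrite sumrB; rewrite sumrB swap -sumrB;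
    under [RHS]eq_bigr do rewrite sumrB.
apply: eq_bigr => i _; rewrite !mxE mulr_sumr; apply: eq_bigr => j ij.
by rewrite gbE// /a /b (gC j i); ring.
Qed.

Unset Implicit Arguments.
Theorem theorem4p5 (R : realType) (n : nat) (e : rel 'I_n) (w : 'M[R]_n)
    (g gb : R -> R -> R)
    (Hgraph : weighted_graph e w)
    (Hg : interpolation g)
    (Hg0 : forall s t, 0 <= s -> 0 <= t -> s * t = 0 -> g s t = 0)
    (Hgb : log_extension g gb)
    (Hxi_lip : [lipschitz xi e w gb mu | mu in @orthant R n])
    (Hxi_C1 : C1_orthant (xi e w gb))
    (T : R) (HT : 0 < T)
    (u0 : 'rV[R]_n -> R) (Hu0 : frechet_C1 u0)
    (sigma : R -> 'rV[R]_n -> 'rV[R]_n)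
    (Hsigma_simplex : forall t mu, 0 <= t <= T -> simplex mu ->
       simplex (sigma t mu))
    (Hsigma_init : forall mu, simplex mu -> sigma 0 mu = mu)
    (Hsigma_ode : forall t mu, 0 <= t <= T -> simplex mu ->
       is_deriv_on `[0, T] (sigma ^~ mu) t (xi e w gb (sigma t mu))) :
  let u := fun t mu => u0 (sigma t mu) in
  [/\ forall t mu, 0 <= t <= T -> simplex mu ->
        (exists l : R^o, is_deriv_on `[0, T] (u ^~ mu : R -> R^o) t l) /\
        frechet_derivable (u t) mu,
      {within `[0, T] `*` @simplex R n,
        continuous (fun p : R * 'rV[R]_n => deriv_on `[0, T] (u ^~ p.2) p.1)},
      {within `[0, T] `*` @simplex R n,
        continuous (fun p : R * 'rV[R]_n => frechet (u p.1) p.2)} &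
      forall t mu, 0 <= t <= T -> simplex mu ->
        deriv_on `[0, T] (u ^~ mu) t = ind_noise e w g gb (u t) mu].
Proof.
move=> u; set X := xi e w gb in Hxi_lip Hxi_C1 Hsigma_ode.
have flow : simplex_flow T X sigma by split.
have [K K0 XK] := lipschitz_onP Hxi_lip.
have Xc := lipschitz_within_continuous K0 XK.
have XL : lipschitz_simplex X.
  by exists K => // a b Sa Sb; apply: XK; exact: sub_simplex_orthant.
have XcS := continuous_subspaceW (@sub_simplex_orthant R n) Xc.
have sc := flow_continuous XL flow.
have [J Jc XJ] := C1_orthant_expansion Xc Hxi_C1.
have [C C0 CP] := flow_lipschitz XL flow.
have uAL : almost_linear T (fun t mu => u t mu : R^o).
  apply: (frechet_C1_comp_almost_linear C0 CP) => //.
  exact: (flow_almost_linear XL flow Jc XJ).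
have comp_c (W : normedModType R) (f : 'rV[R]_n -> W) :
    {within @simplex R n, continuous f} -> {within `[0, T] `*` @simplex R n,
    continuous (fun p : R * 'rV[R]_n => f (sigma p.1 p.2))}.
  move=> /within_continuousP fc.
  move/(@within_continuousP R (R * 'rV[R]_n)%type) : sc => sc.
  apply/(@within_continuousP R (R * 'rV[R]_n)%type) => p [tT Smu] eps eps0.
  have Sp q : (`[0, T]%classic `*` @simplex R n) q -> simplex (sigma q.1 q.2).
    by move=> [+ Sq]; rewrite /= in_itv /= => qT; exact: Hsigma_simplex.
  have [d d0 dP] := fc _ (Sp p (conj tT Smu)) _ eps0.
  have [r r0 rP] := sc p (conj tT Smu) _ (divr_gt0 d0 (ltr0Sn R 1)).
  exists r => // q Aq qp; apply: dP; first exact: Sp.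
  by apply: le_lt_trans (rP q Aq qp) _; lra.
have uc : {within `[0, T] `*` @simplex R n,
    continuous (fun p : R * 'rV[R]_n => u p.1 p.2)}.
  exact: (comp_c R^o u0 (frechet_C1_continuous Hu0)).
have [ud uFc] := almost_linear_frechet uAL uc.
have ut t mu : 0 <= t <= T -> simplex mu -> is_deriv_on `[0, T]
    (u ^~ mu : R -> R^o) t (dotv (frechet u0 (sigma t mu)) (X (sigma t mu))).
  move=> tT Smu; apply: (@frechet_chain_rule _ _ u0 _ (sigma ^~ mu)) => //.
  - by move=> s; rewrite /= in_itv /= => sT; exact: Hsigma_simplex.
  - exact: Hsigma_ode.
pose D t mu := dotv (frechet u0 (sigma t mu)) (X (sigma t mu)).
have utE t mu : 0 <= t <= T -> simplex mu -> deriv_on `[0, T] (u ^~ mu) t = D t mu.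
  by move=> tT Smu; apply: deriv_onE => //; exact: ut.
have Dc : {within `[0, T] `*` @simplex R n,
    continuous (fun p : R * 'rV[R]_n => D p.1 p.2)}.
  by apply: within_continuous_dotv; apply: comp_c => //; case: Hu0.
have section_c (W : normedModType R) (f : R * 'rV[R]_n -> W) mu : simplex mu ->
    {within `[0, T] `*` @simplex R n, continuous f} ->
    {within `[0, T], continuous (fun t => f (t, mu))}.
  move=> Smu /(@within_continuousP R (R * 'rV[R]_n)%type) fc.
  apply/within_continuousP => t tT eps eps0.
  have [d d0 dP] := fc (t, mu) (conj tT Smu) _ eps0; exists d => // s sT st.
  apply: dP => //; rewrite prod_normE /= subrr normr0 gt_max st.
  exact: d0.
have frechet_u_C1 t : 0 <= t <= T -> frechet_C1 (u t).
  move=> tT; split=> [rho Srho|]; first exact: ud.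
  move/(@within_continuousP R (R * 'rV[R]_n)%type) : uFc => uFc.
  apply/within_continuousP => mu Smu eps eps0.
  have tT' : `[0, T]%classic t by rewrite /= in_itv.
  have [d d0 dP] := uFc (t, mu) (conj tT' Smu) _ eps0; exists d => // nu Snu numu.
  apply: (dP (t, nu)) => //; rewrite prod_normE /= subrr normr0 gt_max numu.
  by rewrite d0.
(* The semigroup property turns the time derivative into a space derivative
   along the flow started at mu. *)
have Dlt t mu : 0 <= t < T -> simplex mu -> D t mu = dotv (frechet (u t) mu) (X mu).
  move=> /andP[t0 tT] Smu; have tT' : 0 <= t <= T by rewrite t0 ltW.
  have T0 : (0 : R) <= 0 <= T by rewrite lexx ltW.
  have := @frechet_chain_rule _ _ (u t) `[0, T] (sigma ^~ mu) 0 (X mu).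
  rewrite Hsigma_init// => /(_ (frechet_u_C1 _ tT')) chain.
  have {}chain : is_deriv_on `[0, T - t] (fun s => u t (sigma s mu) : R^o) 0
      (dotv (frechet (u t) mu) (X mu)).
    apply: (@is_deriv_on_subset _ _ _ `[0, T]).
      by move=> s; rewrite /= !in_itv /= => /andP[s0 sT]; apply/andP; split; lra.
    apply: chain.
    - by move=> s; rewrite /= in_itv /= => sT; exact: Hsigma_simplex.
    - by rewrite /= in_itv.
    - by have := Hsigma_ode _ _ T0 Smu; rewrite Hsigma_init.
  have Tt0 : 0 < T - t by rewrite subr_gt0.
  apply: (@is_deriv_on_unique _ R^o (T - t) (fun s => u (s + t) mu) 0) => //.
  - by apply/andP; split=> //; exact: ltW.
  - have := @is_deriv_on_shift _ R^o `[0, T] (u ^~ mu) t 0 (D t mu).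
    rewrite add0r => /(_ (ut _ _ tT' Smu)); apply: is_deriv_on_subset => s.
    by rewrite /= !in_itv /= => /andP[s0 sT]; apply/andP; split; lra.
  - move/is_deriv_onP : chain => chain; apply/is_deriv_onP => eps /chain[d d0 dP].
    have semi s : 0 <= s <= T - t -> u (s + t) mu = u t (sigma s mu).
      move=> /andP[s0 sT]; rewrite /u [s + t]addrC (flow_semigroup XL flow)//.
      by lra.
    exists d => // h hd hT; have := dP h hd hT; rewrite !semi//.
    by rewrite lexx ltW.
have Deq t mu : 0 <= t <= T -> simplex mu -> D t mu = dotv (frechet (u t) mu) (X mu).
  move=> tT Smu; move: (tT) => /andP[t0]; rewrite le_eqVlt => /orP[/eqP tE|tlt].
    (* At t = T no increment forward in time is available; the identity extends
       from [0, T) by continuity. *)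
    pose phi s := D s mu - dotv (frechet (u s) mu) (X mu).
    suff : phi T = 0 by rewrite /phi -tE => /eqP; rewrite subr_eq0 => /eqP.
    have phic : {within `[0, T], continuous (phi : R -> R^o)}.
      apply/subspace_continuousP => s sT; apply: cvgB.
        have := section_c R^o (fun p => D p.1 p.2) mu Smu Dc.
        by move=> /subspace_continuousP; apply.
      apply: cvg_dotv; last exact: cvg_cst.
      have := section_c _ (fun p => frechet (u p.1) p.2) mu Smu uFc.
      by move=> /subspace_continuousP; apply.
    apply/eqP; rewrite -normr_le0; apply/ler_addgt0Pr => eps eps0; rewrite add0r.
    move/within_continuousP : phic => phic.
    have [|d d0 dP] := phic T _ _ eps0; first
      by rewrite /= in_itv /=; apply/andP; split=> //; exact: ltW.
    pose m := Num.min (d / 2) T.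
    have m0 : 0 < m by rewrite lt_min divr_gt0.
    have [md mT] : m <= d / 2 /\ m <= T by split; rewrite ge_min lexx ?orbT.
    have phi0 : phi (T - m) = 0.
      by apply/eqP; rewrite subr_eq0; apply/eqP/Dlt => //; apply/andP; split; lra.
    have := dP (T - m); rewrite phi0 sub0r normrN; apply.
      by rewrite /= in_itv /=; apply/andP; split; lra.
    by rewrite addrAC subrr sub0r normrN gtr0_norm//; lra.
  by apply: Dlt => //; rewrite t0.
split=> //.
- by move=> t mu tT Smu; split; [exists (D t mu); exact: ut|exact: ud].
- apply: subspace_eq_continuous Dc => p; rewrite inE => -[].
  rewrite /= in_itv /= => tT Smu.
  exact/esym/utE.
- by move=> t mu tT Smu; rewrite utE// Deq// (ind_noiseE _ Hgraph Hg Hgb).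
Qed.
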